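(* Let $(D,B,f,g)$ be a weak bialgebra with a weak projection onto the weak Hopf algebra $B$ (antipode $\lambda_B$). Let $t_B^D=\mu_D\circ(D\otimes(f\circ\lambda_B\circ g))\circ\delta_D$, which is idempotent, and let $t_B^D=i_B^D\circ p_B^D$ with $p_B^D:D\rightarrow D^B$, $i_B^D:D^B\rightarrow D$, $p_B^D\circ i_B^D=id_{D^B}$; $D^B$ is a coalgebra with coproduct $\delta_{D^B}=(p_B^D\otimes p_B^D)\circ\delta_D\circ i_B^D$ and counit $\varepsilon_{D^B}=\varepsilon_D\circ i_B^D$. Then $D$ is a weak crossed biproduct of the coalgebra $D^B$ with the algebra $B$ (i.e. with $C=D^B$ and $A=B$), where the morphisms are $\psi_B^{D^B}=(p_B^D\otimes g)\circ\delta_D\circ\mu_D\circ(f\otimes i_B^D)$, $\sigma_B^{D^B}=(p_B^D\otimes g)\circ\delta_D\circ\mu_D\circ(i_B^D\otimes i_B^D)$, $\chi_B^{D^B}=(g\otimes p_B^D)\circ\delta_D\circ\mu_D\circ(i_B^D\otimes f)$, $\tau_B^{D^B}=(g\otimes g)\circ\delta_D\circ\mu_D\circ(i_B^D\otimes f)$, the preunit and precounit are $\nu=(p_B^D\otimes g)\circ\delta_D\circ\eta_D$ and $\upsilon=\varepsilon_D\circ\mu_D\circ(i_B^D\otimes f)$, and, with $\nabla_{D^B\otimes B}$ the idempotent of this weak crossed biproduct, $\delta_{D^B\otimes B}$ its coproduct and $\beta_\nu=(D^B\otimes\mu_B)\circ(\nu\otimes B)$, the following identities hold: $\delta_{D^B\otimes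 B}\circ\beta_\nu=(\beta_\nu\otimes\beta_\nu)\circ\delta_B$, $\tau_B^{D^B}=(\varepsilon_{D^B}\otimes\delta_B)\circ\nabla_{D^B\otimes B}$, and $\upsilon=(\varepsilon_{D^B}\otimes\varepsilon_B)\circ\nabla_{D^B\otimes B}$.
   Context: $\mathcal C$ is a strict braided monoidal category with tensor product $\otimes$, unit object $K$ and braiding $c$, in which every idempotent splits. Algebras have unit $\eta$, product $\mu$; coalgebras counit $\varepsilon$, coproduct $\delta$; $f\wedge g=\mu\circ(f\otimes g)\circ\delta$. Weak bialgebra: algebra and coalgebra $D$ with $\delta_D\circ\mu_D=(\mu_D\otimes\mu_D)\circ(D\otimes c_{D,D}\otimes D)\circ(\delta_D\otimes\delta_D)$; $\varepsilon_D\circ\mu_D\circ(\mu_D\otimes D)=((\varepsilon_D\circ\mu_D)\otimes(\varepsilon_D\circ\mu_D))\circ(D\otimes\delta_D\otimes D)=((\varepsilon_D\circ\mu_D)\otimes(\varepsilon_D\circ\mu_D))\circ(D\otimes(c_{D,D}^{-1}\circ\delta_D)\otimes D)$; $(\delta_D\otimes D)\circ\delta_D\circ\eta_D=(D\otimes\mu_D\otimes D)\circ((\delta_D\circ\eta_D)\otimes(\delta_D\circ\eta_D))=(D\otimes(\mu_D\circ c_{D,D}^{-1})\otimes D)\circ((\delta_D\circ\eta_D)\otimes(\delta_D\circ\eta_D))$. Weak Hopf algebra: additionally an antipode $\lambda_D$ with $id_D\wedge\lambda_D=\Pi_D^L$, $\lambda_D\wedge id_D=\Pi_D^R$, $\lambda_D\wedge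 id_D\wedge\lambda_D=\lambda_D$, where $\Pi_D^L=((\varepsilon_D\circ\mu_D)\otimes D)\circ(D\otimes c_{D,D})\circ((\delta_D\circ\eta_D)\otimes D)$, $\Pi_D^R=(D\otimes(\varepsilon_D\circ\mu_D))\circ(c_{D,D}\otimes D)\circ(D\otimes(\delta_D\circ\eta_D))$. Weak projection $(D,B,f,g)$: $D$ weak bialgebra, $B$ weak Hopf algebra, $f:B\rightarrow D$ algebra and coalgebra morphism, $g:D\rightarrow B$ coalgebra morphism, $g\circ f=id_B$, $g\circ\mu_D\circ(D\otimes f)=\mu_B\circ(g\otimes B)$. Weak crossed product on $C\otimes A$ ($A$ algebra, $C$ object): given $\psi_A^C:A\otimes C\rightarrow C\otimes A$ with $(C\otimes\mu_A)\circ(\psi_A^C\otimes A)\circ(A\otimes\psi_A^C)=\psi_A^C\circ(\mu_A\otimes C)$, $\nabla_{C\otimes A}=(C\otimes\mu_A)\circ((\psi_A^C\circ(\eta_A\otimes C))\otimes A)$ (idempotent, image $C\times A$, injection $i_{C\otimes A}$, projection $p_{C\otimes A}$); $\sigma_A^C:C\otimes C\rightarrow C\otimes A$ with $\nabla_{C\otimes A}\circ\sigma_A^C=\sigma_A^C$; twisted condition $(C\otimes\mu_A)\circ(\sigma_A^C\otimes A)\circ(C\otimes\psi_A^C)\circ(\psi_A^C\otimes C)=(C\otimes\mu_A)\circ(\psi_A^C\otimes A)\circ(A\otimes\sigma_A^C)$; cocycle condition $(C\otimes\mu_A)\circ(\sigma_A^C\otimes A)\circ(C\otimes\sigma_A^C)=(C\otimes\mu_A)\circ(\sigma_A^C\otimes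 A)\circ(C\otimes\psi_A^C)\circ(\sigma_A^C\otimes C)$; product $\mu_{C\otimes A}=(C\otimes\mu_A)\circ(\sigma_A^C\otimes\mu_A)\circ(C\otimes\psi_A^C\otimes A)$. Preunit $\nu:K\rightarrow C\otimes A$, with $\beta_\nu=(C\otimes\mu_A)\circ(\nu\otimes A)$: $(C\otimes\mu_A)\circ(\sigma_A^C\otimes A)\circ(C\otimes\psi_A^C)\circ(\nu\otimes C)=\nabla_{C\otimes A}\circ(C\otimes\eta_A)$, $(C\otimes\mu_A)\circ(\sigma_A^C\otimes A)\circ(C\otimes\nu)=\nabla_{C\otimes A}\circ(C\otimes\eta_A)$, $(C\otimes\mu_A)\circ(\psi_A^C\otimes A)\circ(A\otimes\nu)=\beta_\nu$. Then $C\times A$ is an algebra with product $p_{C\otimes A}\circ\mu_{C\otimes A}\circ(i_{C\otimes A}\otimes i_{C\otimes A})$ and unit $p_{C\otimes A}\circ\nu$. Weak crossed coproduct on $C\otimes A$ ($C$ coalgebra, $A$ object): $\chi_A^C:C\otimes A\rightarrow A\otimes C$ with $(\chi_A^C\otimes C)\circ(C\otimes\chi_A^C)\circ(\delta_C\otimes A)=(A\otimes\delta_C)\circ\chi_A^C$; $\Gamma_{C\otimes A}=(C\otimes A\otimes\varepsilon_C)\circ(C\otimes\chi_A^C)\circ(\delta_C\otimes A)$ (idempotent); $\tau_A^C:C\otimes A\rightarrow A\otimes A$ with $\tau_A^C\circ\Gamma_{C\otimes A}=\tau_A^C$; twisted $(\tau_A^C\otimes C)\circ(C\otimes\chi_A^C)\circ(\delta_C\otimes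 A)=(A\otimes\chi_A^C)\circ(\chi_A^C\otimes A)\circ(C\otimes\tau_A^C)\circ(\delta_C\otimes A)$; cocycle $(\tau_A^C\otimes A)\circ(C\otimes\tau_A^C)\circ(\delta_C\otimes A)=(A\otimes\tau_A^C)\circ(\chi_A^C\otimes A)\circ(C\otimes\tau_A^C)\circ(\delta_C\otimes A)$; coproduct $\delta_{C\otimes A}=(C\otimes\chi_A^C\otimes A)\circ(\delta_C\otimes\tau_A^C)\circ(\delta_C\otimes A)$. Precounit $\upsilon:C\otimes A\rightarrow K$, with $\gamma_\upsilon=(C\otimes\upsilon)\circ(\delta_C\otimes A)$: $(A\otimes\upsilon)\circ(\chi_A^C\otimes A)\circ(C\otimes\tau_A^C)\circ(\delta_C\otimes A)=(\varepsilon_C\otimes A)\circ\Gamma_{C\otimes A}$, $(\upsilon\otimes A)\circ(C\otimes\tau_A^C)\circ(\delta_C\otimes A)=(\varepsilon_C\otimes A)\circ\Gamma_{C\otimes A}$, $(\upsilon\otimes C)\circ(C\otimes\chi_A^C)\circ(\delta_C\otimes A)=\gamma_\upsilon$. Then the image of $\Gamma_{C\otimes A}$ (injection $i$, projection $p$) is a coalgebra with coproduct $(p\otimes p)\circ\delta_{C\otimes A}\circ i$ and counit $\upsilon\circ i$. A weak bialgebra $D$ is a weak crossed biproduct of the coalgebra $C$ with the algebra $A$ (with morphisms $\psi_A^C,\sigma_A^C,\chi_A^C,\tau_A^C$, preunit $\nu$, precounit $\upsilon$) if: $(C\otimes A,\mu_{C\otimes A})$ is a weak crossed product with preunit $\nu$;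 $(C\otimes A,\delta_{C\otimes A})$ is a weak crossed coproduct with precounit $\upsilon$; $\nabla_{C\otimes A}=\Gamma_{C\otimes A}$; there is an isomorphism of algebras and coalgebras $C\times A\rightarrow D$; and $(\varepsilon_C\otimes A)\circ\nu=\eta_A$, $\upsilon\circ(C\otimes\eta_A)=\varepsilon_C$. *)

(* Defs.v *)
Set Implicit Arguments.

Record sbmcat := Sbmcat {
  Ob : Type;
  Mor : Type;
  dom : Mor -> Ob;
  cod : Mor -> Ob;
  idm : Ob -> Mor;
  cmp : Mor -> Mor -> Mor;
  ten : Ob -> Ob -> Ob;
  tenm : Mor -> Mor -> Mor;
  unitK : Ob;
  braid : Ob -> Ob -> Mor;
  braidinv : Ob -> Ob -> Mor;
  dom_id : forall A, dom (idm A) = A;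
  cod_id : forall A, cod (idm A) = A;
  dom_cmp : forall g f, dom g = cod f -> dom (cmp g f) = dom f;
  cod_cmp : forall g f, dom g = cod f -> cod (cmp g f) = cod g;
  cmp_id_r : forall f, cmp f (idm (dom f)) = f;
  cmp_id_l : forall f, cmp (idm (cod f)) f = f;
  cmp_assoc : forall h g f, dom h = cod g -> dom g = cod f ->
      cmp h (cmp g f) = cmp (cmp h g) f;
  dom_tenm : forall f g, dom (tenm f g) = ten (dom f) (dom g);
  cod_tenm : forall f g, cod (tenm f g) = ten (cod f) (cod g);
  tenm_id : forall A B, tenm (idm A) (idm B) = idm (ten A B);
  tenm_cmp : forall g f g' f', dom g = cod f -> dom g' = cod f' ->
      tenm (cmp g f) (cmp g' f') = cmp (tenm g g') (tenm f f');
  ten_assoc : forall A B C, ten (ten A B) C = ten A (ten B C);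
  ten_unit_l : forall A, ten unitK A = A;
  ten_unit_r : forall A, ten A unitK = A;
  tenm_assoc : forall f g h, tenm (tenm f g) h = tenm f (tenm g h);
  tenm_unit_l : forall f, tenm (idm unitK) f = f;
  tenm_unit_r : forall f, tenm f (idm unitK) = f;
  dom_braid : forall A B, dom (braid A B) = ten A B;
  cod_braid : forall A B, cod (braid A B) = ten B A;
  dom_braidinv : forall A B, dom (braidinv A B) = ten B A;
  cod_braidinv : forall A B, cod (braidinv A B) = ten A B;
  braid_inv_l : forall A B, cmp (braidinv A B) (braid A B) = idm (ten A B);
  braid_inv_r : forall A B, cmp (braid A B) (braidinv A B) = idm (ten B A);
  braid_nat : forall f g,
      cmp (braid (cod f) (cod g)) (tenm f g) = cmp (tenm g f) (braid (dom f) (dom g));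
  braid_hex1 : forall A B C,
      braid (ten A B) C = cmp (tenm (braid A C) (idm B)) (tenm (idm A) (braid B C));
  braid_hex2 : forall A B C,
      braid A (ten B C) = cmp (tenm (idm B) (braid A C)) (tenm (braid A B) (idm C));
  idem_split : forall e, dom e = cod e -> cmp e e = e ->
      exists X i p, dom i = X /\ cod i = cod e /\ dom p = cod e /\ cod p = X /\
                    cmp i p = e /\ cmp p i = idm X
}.

Arguments dom {s} _.
Arguments cod {s} _.
Arguments idm {s} _.
Arguments cmp {s} _ _.
Arguments ten {s} _ _.
Arguments tenm {s} _ _.
Arguments unitK {s}.
Arguments braid {s} _ _.
Arguments braidinv {s} _ _.

Declare Scope sbm_scope.
Delimit Scope sbm_scope with sbm.
Notation "g ∘ f" := (cmp g f) (at level 40, left associativity) : sbm_scope.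
Notation "f ⊗ g" := (tenm f g) (at level 35, right associativity) : sbm_scope.
Open Scope sbm_scope.

Section Defs.
Context {S : sbmcat}.
Local Notation Ob := (Ob S).
Local Notation Mor := (Mor S).
Local Notation K := (@unitK S).

Definition hom (f : Mor) (A B : Ob) : Prop := dom f = A /\ cod f = B.

Definition is_algebra (A : Ob) (eta mu : Mor) : Prop :=
  hom eta K A /\ hom mu (ten A A) A /\
  mu ∘ (mu ⊗ idm A) = mu ∘ (idm A ⊗ mu) /\
  mu ∘ (eta ⊗ idm A) = idm A /\ mu ∘ (idm A ⊗ eta) = idm A.

Definition is_coalgebra (C : Ob) (delta eps : Mor) : Prop :=
  hom eps C K /\ hom delta C (ten C C) /\
  (delta ⊗ idm C) ∘ delta = (idm C ⊗ delta) ∘ delta /\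
  (eps ⊗ idm C) ∘ delta = idm C /\ (idm C ⊗ eps) ∘ delta = idm C.

Definition is_algebra_morphism (A : Ob) (eta mu : Mor) (A' : Ob) (eta' mu' : Mor)
  (h : Mor) : Prop :=
  hom h A A' /\ h ∘ eta = eta' /\ h ∘ mu = mu' ∘ (h ⊗ h).

Definition is_coalgebra_morphism (C : Ob) (delta eps : Mor) (C' : Ob) (delta' eps' : Mor)
  (h : Mor) : Prop :=
  hom h C C' /\ delta' ∘ h = (h ⊗ h) ∘ delta /\ eps' ∘ h = eps.

Definition conv (mu delta f g : Mor) : Mor := mu ∘ (f ⊗ g) ∘ delta.

Definition is_weak_bialgebra (D : Ob) (eta mu eps delta : Mor) : Prop :=
  is_algebra D eta mu /\ is_coalgebra D delta eps /\
  delta ∘ mu = (mu ⊗ mu) ∘ (idm D ⊗ braid D D ⊗ idm D) ∘ (delta ⊗ delta) /\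
  eps ∘ mu ∘ (mu ⊗ idm D) =
    ((eps ∘ mu) ⊗ (eps ∘ mu)) ∘ (idm D ⊗ delta ⊗ idm D) /\
  eps ∘ mu ∘ (mu ⊗ idm D) =
    ((eps ∘ mu) ⊗ (eps ∘ mu)) ∘ (idm D ⊗ (braidinv D D ∘ delta) ⊗ idm D) /\
  (delta ⊗ idm D) ∘ delta ∘ eta =
    (idm D ⊗ mu ⊗ idm D) ∘ ((delta ∘ eta) ⊗ (delta ∘ eta)) /\
  (delta ⊗ idm D) ∘ delta ∘ eta =
    (idm D ⊗ (mu ∘ braidinv D D) ⊗ idm D) ∘ ((delta ∘ eta) ⊗ (delta ∘ eta)).

Definition PiL (D : Ob) (eta mu eps delta : Mor) : Mor :=
  ((eps ∘ mu) ⊗ idm D) ∘ (idm D ⊗ braid D D) ∘ ((delta ∘ eta) ⊗ idm D).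

Definition PiR (D : Ob) (eta mu eps delta : Mor) : Mor :=
  (idm D ⊗ (eps ∘ mu)) ∘ (braid D D ⊗ idm D) ∘ (idm D ⊗ (delta ∘ eta)).

Definition is_weak_hopf (D : Ob) (eta mu eps delta lam : Mor) : Prop :=
  is_weak_bialgebra D eta mu eps delta /\ hom lam D D /\
  conv mu delta (idm D) lam = PiL D eta mu eps delta /\
  conv mu delta lam (idm D) = PiR D eta mu eps delta /\
  conv mu delta (conv mu delta lam (idm D)) lam = lam.

Definition is_weak_projection
  (D : Ob) (etaD muD epsD deltaD : Mor)
  (B : Ob) (etaB muB epsB deltaB lamB : Mor) (f g : Mor) : Prop :=
  is_weak_bialgebra D etaD muD epsD deltaD /\
  is_weak_hopf B etaB muB epsB deltaB lamB /\
  is_algebra_morphism B etaB muB D etaD muD f /\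
  is_coalgebra_morphism B deltaB epsB D deltaD epsD f /\
  is_coalgebra_morphism D deltaD epsD B deltaB epsB g /\
  g ∘ f = idm B /\
  g ∘ muD ∘ (idm D ⊗ f) = muB ∘ (g ⊗ idm B).

Section WCP.
Variables (C A : Ob) (etaA muA psi sigma nu : Mor).

Definition nablaP : Mor := (idm C ⊗ muA) ∘ ((psi ∘ (etaA ⊗ idm C)) ⊗ idm A).
Definition betaP : Mor := (idm C ⊗ muA) ∘ (nu ⊗ idm A).
Definition muP : Mor := (idm C ⊗ muA) ∘ (sigma ⊗ muA) ∘ (idm C ⊗ psi ⊗ idm A).

Definition is_weak_crossed_product_preunit : Prop :=
  hom psi (ten A C) (ten C A) /\ hom sigma (ten C C) (ten C A) /\
  hom nu K (ten C A) /\
  (idm C ⊗ muA) ∘ (psi ⊗ idm A) ∘ (idm A ⊗ psi) = psi ∘ (muA ⊗ idm C) /\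
  nablaP ∘ nablaP = nablaP /\
  nablaP ∘ sigma = sigma /\
  (idm C ⊗ muA) ∘ (sigma ⊗ idm A) ∘ (idm C ⊗ psi) ∘ (psi ⊗ idm C) =
    (idm C ⊗ muA) ∘ (psi ⊗ idm A) ∘ (idm A ⊗ sigma) /\
  (idm C ⊗ muA) ∘ (sigma ⊗ idm A) ∘ (idm C ⊗ sigma) =
    (idm C ⊗ muA) ∘ (sigma ⊗ idm A) ∘ (idm C ⊗ psi) ∘ (sigma ⊗ idm C) /\
  (idm C ⊗ muA) ∘ (sigma ⊗ idm A) ∘ (idm C ⊗ psi) ∘ (nu ⊗ idm C) =
    nablaP ∘ (idm C ⊗ etaA) /\
  (idm C ⊗ muA) ∘ (sigma ⊗ idm A) ∘ (idm C ⊗ nu) = nablaP ∘ (idm C ⊗ etaA) /\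
  (idm C ⊗ muA) ∘ (psi ⊗ idm A) ∘ (idm A ⊗ nu) = betaP.
End WCP.

Section WCC.
Variables (C A : Ob) (deltaC epsC chi tau ups : Mor).

Definition GammaC : Mor :=
  (idm C ⊗ idm A ⊗ epsC) ∘ (idm C ⊗ chi) ∘ (deltaC ⊗ idm A).
Definition gammaC : Mor := (idm C ⊗ ups) ∘ (deltaC ⊗ idm A).
Definition deltaP : Mor :=
  (idm C ⊗ chi ⊗ idm A) ∘ (deltaC ⊗ tau) ∘ (deltaC ⊗ idm A).

Definition is_weak_crossed_coproduct_precounit : Prop :=
  hom chi (ten C A) (ten A C) /\ hom tau (ten C A) (ten A A) /\
  hom ups (ten C A) K /\
  (chi ⊗ idm C) ∘ (idm C ⊗ chi) ∘ (deltaC ⊗ idm A) = (idm A ⊗ deltaC) ∘ chi /\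
  GammaC ∘ GammaC = GammaC /\
  tau ∘ GammaC = tau /\
  (tau ⊗ idm C) ∘ (idm C ⊗ chi) ∘ (deltaC ⊗ idm A) =
    (idm A ⊗ chi) ∘ (chi ⊗ idm A) ∘ (idm C ⊗ tau) ∘ (deltaC ⊗ idm A) /\
  (tau ⊗ idm A) ∘ (idm C ⊗ tau) ∘ (deltaC ⊗ idm A) =
    (idm A ⊗ tau) ∘ (chi ⊗ idm A) ∘ (idm C ⊗ tau) ∘ (deltaC ⊗ idm A) /\
  (idm A ⊗ ups) ∘ (chi ⊗ idm A) ∘ (idm C ⊗ tau) ∘ (deltaC ⊗ idm A) =
    (epsC ⊗ idm A) ∘ GammaC /\
  (ups ⊗ idm A) ∘ (idm C ⊗ tau) ∘ (deltaC ⊗ idm A) = (epsC ⊗ idm A) ∘ GammaC /\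
  (ups ⊗ idm C) ∘ (idm C ⊗ chi) ∘ (deltaC ⊗ idm A) = gammaC.
End WCC.

(* D (weak bialgebra) is a weak crossed biproduct of the coalgebra
   (C, deltaC, epsC) with the algebra (A, etaA, muA).  The image C × A of the
   idempotent nabla = Gamma is taken with an arbitrary splitting (i, p): all
   splittings are isomorphic and the induced structures correspond. *)
Definition is_weak_crossed_biproduct
  (D : Ob) (etaD muD epsD deltaD : Mor)
  (C : Ob) (deltaC epsC : Mor) (A : Ob) (etaA muA : Mor)
  (psi sigma chi tau nu ups : Mor) : Prop :=
  is_weak_crossed_product_preunit C A etaA muA psi sigma nu /\
  is_weak_crossed_coproduct_precounit C A deltaC epsC chi tau ups /\
  nablaP C A etaA muA psi = GammaC C A deltaC epsC chi /\
  (forall (X : Ob) (i p : Mor),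
     hom i X (ten C A) -> hom p (ten C A) X ->
     i ∘ p = nablaP C A etaA muA psi -> p ∘ i = idm X ->
     exists alpha alpha' : Mor,
       hom alpha X D /\ hom alpha' D X /\
       alpha' ∘ alpha = idm X /\ alpha ∘ alpha' = idm D /\
       is_algebra_morphism X (p ∘ nu) (p ∘ muP C A muA psi sigma ∘ (i ⊗ i))
                           D etaD muD alpha /\
       is_coalgebra_morphism X ((p ⊗ p) ∘ deltaP C A deltaC chi tau ∘ i) (ups ∘ i)
                             D deltaD epsD alpha) /\
  (epsC ⊗ idm A) ∘ nu = etaA /\
  ups ∘ (idm C ⊗ etaA) = epsC.

End Defs.

(* Main.v *)
(** The map [w = muD ∘ (iD ⊗ f) : DB ⊗ B -> D] is split by
    [w' = (pD ⊗ g) ∘ deltaD], since [d_1 f(PiR(g(d_2))) = d].  Write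
    [t(d) = d_1 f(lam(g(d_2)))].  Then [t(d)_1 ⊗ g(t(d)_2) = t(d) f(1_1) ⊗ 1_2],
    so that [t(t(d) f(b)) = t(d) f(PiL(b))]; as [b |-> PiL(b_1) ⊗ b_2] is right
    linear, the idempotent [w' ∘ w], and hence [w'] itself, is right [B]-linear.
    This avoids the antimultiplicativity of the antipode.  Applying the counit of
    [B] to the linearity of [w'] gives [p(d f(b)) = p(d_1) eps(d_2 f(b))], from
    which [p] is a coalgebra morphism and [w] is left [DB]-colinear.  All the
    axioms of the biproduct follow formally from [w ∘ w' = id], the linearity of
    [w'] and the colinearity of [w]: the crossed structures are the structures of
    [D] transported along [w] and [w']. *)

From Stdlib Require Import List Arith Bool.
Require Import Defs.
Import ListNotations.

Set Implicit Arguments.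

(** * Deciding equality in strict monoidal categories *)

Section Typing.
Context {S : sbmcat}.

Lemma idm_hom (A : Ob S) : hom (idm A) A A.
Proof. split; [apply dom_id | apply cod_id]. Qed.

Lemma cmp_hom (h k : Mor S) A B C : hom k A B -> hom h B C -> hom (h ∘ k) A C.
Proof.
intros [H1 H2] [H3 H4]; split.
- rewrite dom_cmp; congruence.
- rewrite cod_cmp; congruence.
Qed.

Lemma tenm_hom (h k : Mor S) A B C D :
  hom h A B -> hom k C D -> hom (h ⊗ k) (ten A C) (ten B D).
Proof.
intros [H1 H2] [H3 H4]; split.
- rewrite dom_tenm; congruence.
- rewrite cod_tenm; congruence.
Qed.

Lemma cmp_idl (h : Mor S) A B : hom h A B -> idm B ∘ h = h.
Proof. intros [_ <-]; apply cmp_id_l. Qed.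

Lemma cmp_idr (h : Mor S) A B : hom h A B -> h ∘ idm A = h.
Proof. intros [<- _]; apply cmp_id_r. Qed.

Lemma cmpA (h k l : Mor S) A B C D :
  hom l A B -> hom k B C -> hom h C D -> h ∘ (k ∘ l) = h ∘ k ∘ l.
Proof. intros [? ?] [? ?] [? ?]; apply cmp_assoc; congruence. Qed.

Lemma interchange (h k h' k' : Mor S) A B C A' B' C' :
  hom k A B -> hom h B C -> hom k' A' B' -> hom h' B' C' ->
  (h ∘ k) ⊗ (h' ∘ k') = (h ⊗ h') ∘ (k ⊗ k').
Proof. intros [? ?] [? ?] [? ?] [? ?]; apply tenm_cmp; congruence. Qed.

Lemma whisker_cmp (h k : Mor S) L R A B C :
  hom k A B -> hom h B C ->
  idm L ⊗ (h ∘ k) ⊗ idm R = (idm L ⊗ h ⊗ idm R) ∘ (idm L ⊗ k ⊗ idm R).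
Proof.
intros Hk Hh.
rewrite <- (cmp_idl (idm_hom L)) at 1; rewrite <- (cmp_idl (idm_hom R)) at 1.
rewrite (interchange Hk Hh (idm_hom R) (idm_hom R)).
apply (interchange (idm_hom L) (idm_hom L) (tenm_hom Hk (idm_hom R))
                   (tenm_hom Hh (idm_hom R))).
Qed.

Lemma slide (h k : Mor S) L A A' B B' :
  hom h A A' -> hom k B B' ->
  (idm L ⊗ idm A' ⊗ k) ∘ (idm L ⊗ h ⊗ idm B) =
  (idm L ⊗ h ⊗ idm B') ∘ (idm L ⊗ idm A ⊗ k).
Proof.
intros Hh Hk.
rewrite <- (interchange (idm_hom L) (idm_hom L) (tenm_hom Hh (idm_hom B))
                        (tenm_hom (idm_hom A') Hk)).
rewrite <- (interchange (idm_hom L) (idm_hom L) (tenm_hom (idm_hom A) Hk)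
                        (tenm_hom Hh (idm_hom B'))).
rewrite <- (interchange Hh (idm_hom A') (idm_hom B) Hk).
rewrite <- (interchange (idm_hom A) Hh Hk (idm_hom B')).
now rewrite (cmp_idl Hh), (cmp_idr Hh), (cmp_idl Hk), (cmp_idr Hk).
Qed.

End Typing.

(** * String diagrams as lists of whiskered generators *)

Section Diagrams.
Context {S : sbmcat} (oe : list (Ob S)) (ms : list (Mor S)) (sg : list (list nat * list nat)).
Local Notation word := (list nat).

Definition ob (n : nat) : Ob S := nth n oe unitK.

(** One-letter words get their own case so that no trailing unit appears: [obj] of a word is then
    convertible to the right-nested tensor product that [diag] reads off. *)
Fixpoint obj (w : word) : Ob S :=
  match w with [] => unitK | [x] => ob x | x :: w' => ten (ob x) (obj w') end.

Definition src (n : nat) : word := fst (nth n sg ([], [])).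
Definition tgt (n : nat) : word := snd (nth n sg ([], [])).
(** The default is typed by the default words of [src] and [tgt], so [mor_hom] holds for every
    [n]. *)
Definition mor (n : nat) : Mor S := nth n ms (idm unitK).

Inductive term := Gen (n : nat) | Id (w : word) | Cmp (t u : term) | Ten (t u : term).

Fixpoint eval (t : term) : Mor S :=
  match t with
  | Gen n => mor n
  | Id w => idm (obj w)
  | Cmp t u => eval t ∘ eval u
  | Ten t u => eval t ⊗ eval u
  end.

(* [(l, n, r)] stands for the generator [n] with identity wires [l] on its left
   and [r] on its right. *)
Definition slice := (word * nat * word)%type.
Definition ssrc (s : slice) : word := let '(l, n, r) := s in l ++ src n ++ r.
Definition stgt (s : slice) : word := let '(l, n, r) := s in l ++ tgt n ++ r.
Definition seval (s : slice) : Mor S :=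
  let '(l, n, r) := s in idm (obj l) ⊗ mor n ⊗ idm (obj r).
Definition whisk (l r : word) (s : slice) : slice :=
  let '(l', n, r') := s in (l ++ l', n, r' ++ r).

Fixpoint chain (a : word) (ss : list slice) (b : word) : Prop :=
  match ss with [] => a = b | s :: ss' => a = ssrc s /\ chain (stgt s) ss' b end.
Fixpoint ceval (a : word) (ss : list slice) : Mor S :=
  match ss with [] => idm (obj a) | s :: ss' => ceval (stgt s) ss' ∘ seval s end.

Definition weq (a b : word) : bool := if list_eq_dec Nat.eq_dec a b then true else false.

(** The result is source word, slices in order of application, target word. In a tensor product all
    slices of the left factor come first. *)
Fixpoint flat (t : term) : option (word * list slice * word) :=
  match t with
  | Gen n => Some (src n, [([], n, [])], tgt n)
  | Id w => Some (w, [], w)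
  | Cmp t u =>
      match flat u, flat t with
      | Some (a, ss, b), Some (b', ss', c) =>
          if weq b b' then Some (a, ss ++ ss', c) else None
      | _, _ => None
      end
  | Ten t u =>
      match flat t, flat u with
      | Some (a, ss, b), Some (a', ss', b') =>
          Some (a ++ a', map (whisk [] a') ss ++ map (whisk b []) ss', b ++ b')
      | _, _ => None
      end
  end.

Fixpoint strip (a b : word) : option word :=
  match a, b with
  | [], _ => Some b
  | x :: a', y :: b' => if Nat.eqb x y then strip a' b' else None
  | _, _ => None
  end.

(* A generator acting entirely to the left of the preceding one is moved before
   it; iterating this brings diagrams that agree up to interchange to a common form. *)
Fixpoint bubble (ss : list slice) : list slice :=
  match ss with
  | (l1, x, r1) as s :: ss' =>
      match bubble ss' with
      | (l2, y, r2) :: ss'' =>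
          (* [Some m] means that the later generator [y] lies wholly to the left of [x], with [m]
             the wires between them. *)
          match strip (l2 ++ src y) l1 with
          | Some m => if weq r2 (m ++ tgt x ++ r1) then
              (l2, y, m ++ src x ++ r1) :: (l2 ++ tgt y ++ m, x, r1) :: ss''
              else s :: (l2, y, r2) :: ss''
          | None => s :: (l2, y, r2) :: ss''
          end
      | [] => [s]
      end
  | [] => []
  end.

(** Soundness holds for any number of rounds; too few could only make [check] fail. *)
Definition normal (ss : list slice) : list slice :=
  Nat.iter (length ss + length ss) bubble ss.

(** Transparent, because [check] is evaluated by [vm_compute]. *)
Definition slice_eq_dec (s s' : slice) : {s = s'} + {s <> s'}.
Proof. repeat decide equality. Defined.

Definition check (t u : term) : bool :=
  match flat t, flat u with
  | Some (a, ss, _), Some (a', ss', _) =>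
      weq a a' &&
      if list_eq_dec slice_eq_dec (normal ss) (normal ss') then true else false
  | _, _ => false
  end.

(** * Soundness of the decision procedure *)

Lemma weq_eq a b : weq a b = true -> a = b.
Proof. unfold weq; now destruct (list_eq_dec _ a b). Qed.

Lemma strip_app a b m : strip a b = Some m -> b = a ++ m.
Proof.
revert b; induction a as [|x a IH]; intros [|y b]; simpl; try congruence.
destruct (Nat.eqb_spec x y); [intros H | discriminate].
subst; now rewrite (IH _ H).
Qed.

Lemma obj_app a b : obj (a ++ b) = ten (obj a) (obj b).
Proof.
assert (cons : forall x w, obj (x :: w) = ten (ob x) (obj w)).
{ intros x [|y w]; [symmetry; apply ten_unit_r | reflexivity]. }
induction a as [|x a IH]; [symmetry; apply ten_unit_l |].
now simpl app; rewrite !cons, IH, ten_assoc.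
Qed.

Hypothesis typed :
  Forall2 (fun m s => hom m (obj (fst s)) (obj (snd s))) ms sg.

Lemma mor_hom n : hom (mor n) (obj (src n)) (obj (tgt n)).
Proof.
unfold mor, src, tgt; revert n.
elim typed; [|intros m s ms' sg' Hm _ IH]; intros [|n]; simpl; auto using idm_hom.
Qed.

Lemma seval_hom s : hom (seval s) (obj (ssrc s)) (obj (stgt s)).
Proof.
destruct s as [[l n] r]; simpl; rewrite !obj_app.
auto using tenm_hom, idm_hom, mor_hom.
Qed.

Lemma ceval_hom {a ss b} : chain a ss b -> hom (ceval a ss) (obj a) (obj b).
Proof.
revert a; induction ss as [|s ss IH]; simpl; intros a.
- intros <-; apply idm_hom.
- intros [-> H]; exact (cmp_hom (seval_hom s) (IH _ H)).
Qed.

Lemma chain_app {a ss b ss' c} :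
  chain a ss b -> chain b ss' c ->
  chain a (ss ++ ss') c /\ ceval a (ss ++ ss') = ceval b ss' ∘ ceval a ss.
Proof.
revert a; induction ss as [|s ss IH]; simpl; intros a.
- intros <- H; split; trivial.
  symmetry; exact (cmp_idr (ceval_hom H)).
- intros [-> H] H'; destruct (IH _ H H') as [H1 ->].
  split; auto.
  symmetry; exact (cmpA (seval_hom s) (ceval_hom H) (ceval_hom H')).
Qed.

Lemma seval_whisk l r s :
  seval (whisk l r s) = idm (obj l) ⊗ seval s ⊗ idm (obj r).
Proof.
destruct s as [[l' n] r']; simpl.
now rewrite !obj_app, <- !tenm_id, !tenm_assoc.
Qed.

Lemma ssrc_whisk l r s : ssrc (whisk l r s) = l ++ ssrc s ++ r.
Proof. destruct s as [[l' n] r']; simpl; now rewrite !app_assoc. Qed.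

Lemma stgt_whisk l r s : stgt (whisk l r s) = l ++ stgt s ++ r.
Proof. destruct s as [[l' n] r']; simpl; now rewrite !app_assoc. Qed.

Lemma chain_whisk l r {a ss b} :
  chain a ss b ->
  chain (l ++ a ++ r) (map (whisk l r) ss) (l ++ b ++ r) /\
  ceval (l ++ a ++ r) (map (whisk l r) ss) = idm (obj l) ⊗ ceval a ss ⊗ idm (obj r).
Proof.
revert a; induction ss as [|s ss IH]; simpl; intros a.
- intros <-; split; trivial. now rewrite !obj_app, !tenm_id.
- intros [-> H]; destruct (IH _ H) as [H1 H2].
  rewrite ssrc_whisk, stgt_whisk; repeat split; auto.
  rewrite H2, seval_whisk.
  symmetry; exact (whisker_cmp (obj l) (obj r) (seval_hom s) (ceval_hom H)).
Qed.

Lemma flat_correct t a ss b :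
  flat t = Some (a, ss, b) -> chain a ss b /\ eval t = ceval a ss.
Proof.
revert a ss b; induction t as [n|w|t IHt u IHu|t IHt u IHu]; simpl; intros a ss b.
- intros [= <- <- <-]; simpl; rewrite !app_nil_r; repeat split.
  rewrite tenm_unit_l, tenm_unit_r; symmetry; eapply cmp_idl, mor_hom.
- intros [= <- <- <-]; now split.
- destruct (flat u) as [[[a1 s1] b1]|]; [|discriminate].
  destruct (flat t) as [[[a2 s2] b2]|]; [|discriminate].
  destruct (IHu _ _ _ eq_refl) as [H1 ->]; destruct (IHt _ _ _ eq_refl) as [H2 ->].
  destruct (weq b1 a2) eqn:E; [apply weq_eq in E; subst | discriminate].
  intros [= <- <- <-].
  destruct (chain_app H1 H2) as [H ->]; now split.
- destruct (flat t) as [[[a1 s1] b1]|]; [|discriminate].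
  destruct (flat u) as [[[a2 s2] b2]|]; [|discriminate].
  destruct (IHu _ _ _ eq_refl) as [H1 ->]; destruct (IHt _ _ _ eq_refl) as [H2 ->].
  intros [= <- <- <-].
  destruct (chain_whisk [] a2 H2) as [H3 E3].
  destruct (chain_whisk b1 [] H1) as [H4 E4].
  simpl app in H3, E3; rewrite !app_nil_r in H4; rewrite !app_nil_r in E4.
  destruct (chain_app H3 H4) as [H ->]; split; [exact H |].
  rewrite E3, E4; simpl obj; rewrite tenm_unit_l, tenm_unit_r.
  rewrite <- (interchange (ceval_hom H2) (idm_hom _) (idm_hom _) (ceval_hom H1)).
  now rewrite (cmp_idl (ceval_hom H2)), (cmp_idr (ceval_hom H1)).
Qed.

Theorem flat_hom t a ss b : flat t = Some (a, ss, b) -> hom (eval t) (obj a) (obj b).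
Proof. intros H; destruct (flat_correct _ H) as [H' ->]; exact (ceval_hom H'). Qed.

Lemma slice_swap l x m y r :
  seval (l ++ tgt y ++ m, x, r) ∘ seval (l, y, m ++ src x ++ r) =
  seval (l, y, m ++ tgt x ++ r) ∘ seval (l ++ src y ++ m, x, r).
Proof.
simpl; rewrite !obj_app, <- !tenm_id, !tenm_assoc.
(* The identities are merged so that the block formed by [m], [x] and [r] counts as one morphism in
   [slide]. *)
rewrite (tenm_id _ (obj (src x))), (tenm_id _ (obj (tgt x))), !(tenm_id _ (obj m)).
apply (slide (obj l) (mor_hom y)
             (tenm_hom (idm_hom (obj m)) (tenm_hom (mor_hom x) (idm_hom (obj r))))).
Qed.

Lemma bubble_correct a ss b :
  chain a ss b -> chain a (bubble ss) b /\ ceval a (bubble ss) = ceval a ss.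
Proof.
revert a; induction ss as [|[[l1 x] r1] ss IH]; intros a; [now split |].
intros [-> H]; destruct (IH _ H) as [H1 E1]; clear IH; simpl bubble.
destruct (bubble ss) as [|[[l2 y] r2] ss''].
{ simpl in *; now rewrite <- E1. }
(* The outcome when no swap takes place. *)
assert (keep : chain (ssrc (l1, x, r1)) ((l1, x, r1) :: (l2, y, r2) :: ss'') b /\
  ceval (ssrc (l1, x, r1)) ((l1, x, r1) :: (l2, y, r2) :: ss'') =
  ceval (ssrc (l1, x, r1)) ((l1, x, r1) :: ss)).
{ split; [now split |].
  exact (f_equal (fun h => h ∘ seval (l1, x, r1)) E1). }
destruct (strip (l2 ++ src y) l1) as [m|] eqn:El; [apply strip_app in El; rewrite <- app_assoc in El | exact keep].
destruct (weq r2 (m ++ tgt x ++ r1)) eqn:Er; [apply weq_eq in Er | exact keep].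
destruct keep as [[_ [_ H2]] E]; subst l1 r2.
split.
- simpl in *; rewrite !app_assoc in *; repeat split; assumption.
- refine (eq_trans _ E).
  (* The boundary words on the two sides of the swap agree only up to associativity of [++]. *)
  assert (Ha : ssrc (l2, y, m ++ src x ++ r1) = ssrc (l2 ++ src y ++ m, x, r1))
    by (simpl; now rewrite <- !app_assoc).
  assert (Hb : stgt (l2 ++ tgt y ++ m, x, r1) = stgt (l2, y, m ++ tgt x ++ r1))
    by (simpl; now rewrite <- !app_assoc).
  assert (Hc : stgt (l2, y, m ++ src x ++ r1) = ssrc (l2 ++ tgt y ++ m, x, r1))
    by (simpl; now rewrite <- !app_assoc).
  assert (Hd : stgt (l2 ++ src y ++ m, x, r1) = ssrc (l2, y, m ++ tgt x ++ r1))
    by (simpl; now rewrite <- !app_assoc).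
  cbn [ceval]; rewrite Hb.
  assert (Hss := ceval_hom H2).
  assert (G1 := seval_hom (l2, y, m ++ src x ++ r1)).
  assert (G2 := seval_hom (l2 ++ src y ++ m, x, r1)).
  assert (G3 := seval_hom (l2 ++ tgt y ++ m, x, r1)).
  assert (G4 := seval_hom (l2, y, m ++ tgt x ++ r1)).
  rewrite Hc in G1; rewrite Hd in G2; rewrite Hb in G3.
  rewrite <- (cmpA G1 G3 Hss), <- (cmpA G2 G4 Hss).
  apply f_equal, slice_swap.
Qed.

Lemma normal_correct {a ss b} :
  chain a ss b -> chain a (normal ss) b /\ ceval a (normal ss) = ceval a ss.
Proof.
intros H; unfold normal; induction (length ss + length ss) as [|n [H1 <-]]; [now split |].
now apply bubble_correct.
Qed.

Theorem check_correct t u : check t u = true -> eval t = eval u.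
Proof.
unfold check.
destruct (flat t) as [[[a ss] b]|] eqn:Et; [|discriminate].
destruct (flat u) as [[[a' ss'] b']|] eqn:Eu; [|discriminate].
rewrite andb_true_iff; intros [Ea Es].
apply weq_eq in Ea; subst a'.
destruct (list_eq_dec _ _ _) as [E|]; [|discriminate].
apply flat_correct in Et, Eu; destruct Et as [Ht ->], Eu as [Hu ->].
now rewrite <- (proj2 (normal_correct Ht)), E, (proj2 (normal_correct Hu)).
Qed.
End Diagrams.

(* Reification of morphisms *)
(* As a class, [hom] lets the tactics find the source and target of a generator by instance
   search. *)
Existing Class hom.

Ltac index_in x l :=
  lazymatch l with
  | x :: _ => constr:(0)
  | _ :: ?l' => let n := index_in x l' in constr:(Datatypes.S n)
  end.

Ltac insert_in x l :=
  lazymatch l with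
  | context [x :: _] => l
  | _ => constr:(x :: l)
  end.

Ltac objects X l :=
  lazymatch X with
  | ten ?A ?B => let l' := objects A l in objects B l'
  | unitK => l
  | _ => insert_in X l
  end.

Ltac atoms h l :=
  lazymatch h with
  | cmp ?h1 ?h2 => let l' := atoms h1 l in atoms h2 l'
  | tenm ?h1 ?h2 => let l' := atoms h1 l in atoms h2 l'
  | idm _ => l
  | _ => insert_in h l
  end.

Ltac id_objects h l :=
  lazymatch h with
  | cmp ?h1 ?h2 => let l' := id_objects h1 l in id_objects h2 l'
  | tenm ?h1 ?h2 => let l' := id_objects h1 l in id_objects h2 l'
  | idm ?A => objects A l
  | _ => l
  end.

Ltac type_of_atom m :=
  let H := constr:(_ : hom m _ _) in
  lazymatch type of H with hom _ ?A ?B => constr:((A, B)) end.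

Ltac atom_objects ms l :=
  lazymatch ms with
  | ?m :: ?ms' =>
      lazymatch type_of_atom m with
      | (?A, ?B) => let l1 := objects A l in let l2 := objects B l1 in atom_objects ms' l2
      end
  | _ => l
  end.

Ltac word_of oe X :=
  lazymatch X with
  | ten ?A ?B => let v := word_of oe A in let w := word_of oe B in
                 eval cbv [app] in (v ++ w)
  | unitK => constr:(@nil nat)
  | _ => let n := index_in X oe in constr:([n])
  end.

Ltac signature oe ms :=
  lazymatch ms with
  | ?m :: ?ms' =>
      lazymatch type_of_atom m with
      | (?A, ?B) =>
          let v := word_of oe A in let w := word_of oe B in
          let sg := signature oe ms' in constr:((v, w) :: sg)
      end
  | _ => constr:(@nil (list nat * list nat))
  end.

Ltac reify oe ms h :=
  lazymatch h with
  | cmp ?h1 ?h2 =>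
      let t1 := reify oe ms h1 in let t2 := reify oe ms h2 in constr:(Cmp t1 t2)
  | tenm ?h1 ?h2 =>
      let t1 := reify oe ms h1 in let t2 := reify oe ms h2 in constr:(Ten t1 t2)
  | idm ?A => let w := word_of oe A in constr:(Id w)
  | _ => let n := index_in h ms in constr:(Gen n)
  end.

Ltac typed_atoms :=
  repeat (apply Forall2_cons;
    [ lazymatch goal with
      | |- hom ?m _ _ => let H := constr:(_ : hom m _ _) in exact H
      end |]);
  apply Forall2_nil.

(* Decides equality modulo the axioms of a strict monoidal category. *)
Ltac diag :=
  lazymatch goal with
  | |- @eq (Mor ?C) ?h ?k =>
      let ms0 := atoms h (@nil (Mor C)) in let ms := atoms k ms0 in
      let o0 := id_objects h (@nil (Ob C)) in let o1 := id_objects k o0 in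
      let oe := atom_objects ms o1 in
      let sg := signature oe ms in
      let t := reify oe ms h in let u := reify oe ms k in
      change (eval oe ms t = eval oe ms u);
      apply (@check_correct C oe ms sg); [typed_atoms | vm_compute; reflexivity]
  end.

Ltac diag_hom :=
  lazymatch goal with
  | |- @hom ?C ?h ?A ?B =>
      let ms := atoms h (@nil (Mor C)) in
      let o := id_objects h (@nil (Ob C)) in
      let oe := atom_objects ms o in
      let sg := signature oe ms in
      let t := reify oe ms h in
      let a := word_of oe A in let b := word_of oe B in
      change (hom (eval oe ms t) (obj oe a) (obj oe b));
      eapply (@flat_hom C oe ms sg); [typed_atoms | vm_compute; reflexivity]
  end.

(* Rewriting modulo the strict monoidal axioms: [X] is the left-hand side rearranged so that the
   next redex is a literal subterm. *)
Tactic Notation "via" constr(X) := transitivity X; [diag |].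

#[local] Existing Instance cmp_hom.

Unset Implicit Arguments.

(** * Naturality of the braiding *)

Section Braiding.
Context {S : sbmcat}.
Implicit Types (A B C Z : Ob S) (h : Mor S).

#[local] Instance braid_hom A B : hom (braid A B) (ten A B) (ten B A).
Proof. split; [apply dom_braid | apply cod_braid]. Qed.

#[local] Instance braidinv_hom A B : hom (braidinv A B) (ten B A) (ten A B).
Proof. split; [apply dom_braidinv | apply cod_braidinv]. Qed.

Lemma braid_slide_l h {A B Z} {H : hom h A B} :
  braid B Z ∘ (h ⊗ idm Z) = (idm Z ⊗ h) ∘ braid A Z.
Proof.
destruct H as [<- <-]; generalize (braid_nat _ h (idm Z)); now rewrite dom_id, cod_id.
Qed.

Lemma braid_slide_r h {A B Z} {H : hom h A B} :
  braid Z B ∘ (idm Z ⊗ h) = (h ⊗ idm Z) ∘ braid Z A.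
Proof.
destruct H as [<- <-]; generalize (braid_nat _ (idm Z) h); now rewrite dom_id, cod_id.
Qed.

(** The hexagon makes this braiding idempotent, and it is invertible. *)
Lemma braid_K_l Z : braid unitK Z = idm Z.
Proof.
assert (E := braid_hex1 S unitK unitK Z).
rewrite tenm_unit_l, tenm_unit_r, ten_unit_l in E.
assert (H := braid_hom unitK Z); assert (H' := braidinv_hom unitK Z).
rewrite ten_unit_l, ten_unit_r in H, H'.
rewrite <- (cmp_idl H), <- (tenm_unit_l _ (idm Z)), tenm_id, <- braid_inv_l.
rewrite <- (cmpA H H H'), <- E; reflexivity.
Qed.

Lemma braid_K_r Z : braid Z unitK = idm Z.
Proof.
assert (E := braid_hex2 S Z unitK unitK).
rewrite tenm_unit_l, tenm_unit_r, ten_unit_l in E.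
assert (H := braid_hom Z unitK); assert (H' := braidinv_hom Z unitK).
rewrite ten_unit_l, ten_unit_r in H, H'.
rewrite <- (cmp_idl H), <- (tenm_unit_r _ (idm Z)), tenm_id, <- braid_inv_l.
rewrite <- (cmpA H H H'), <- E; reflexivity.
Qed.

Lemma braid_merge_l h {A B C Z} {H : hom h (ten A B) C} :
  braid C Z ∘ (h ⊗ idm Z) =
  (idm Z ⊗ h) ∘ (braid A Z ⊗ idm B) ∘ (idm A ⊗ braid B Z).
Proof. rewrite (braid_slide_l h), braid_hex1; diag. Qed.

Lemma braid_merge_r h {A B C Z} {H : hom h (ten A B) C} :
  braid Z C ∘ (idm Z ⊗ h) =
  (h ⊗ idm Z) ∘ (idm A ⊗ braid Z B) ∘ (braid Z A ⊗ idm B).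
Proof. rewrite (braid_slide_r h), braid_hex2; diag. Qed.

Lemma braid_split_l h {A B C Z} {H : hom h C (ten A B)} :
  (idm Z ⊗ h) ∘ braid C Z =
  (braid A Z ⊗ idm B) ∘ (idm A ⊗ braid B Z) ∘ (h ⊗ idm Z).
Proof. rewrite <- (braid_slide_l h), braid_hex1; diag. Qed.

Lemma braid_split_r h {A B C Z} {H : hom h C (ten A B)} :
  (h ⊗ idm Z) ∘ braid Z C =
  (idm A ⊗ braid Z B) ∘ (braid Z A ⊗ idm B) ∘ (idm Z ⊗ h).
Proof. rewrite <- (braid_slide_r h), braid_hex2; diag. Qed.

(** Crossing both legs of a cup amounts to crossing the unit wire, which is trivial. *)
Lemma braid_cup_l h {A B Z} {H : hom h unitK (ten A B)} :
  (braid A Z ⊗ idm B) ∘ (idm A ⊗ braid B Z) ∘ (h ⊗ idm Z) = idm Z ⊗ h.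
Proof. rewrite <- (braid_split_l h), braid_K_l; diag. Qed.

Lemma braid_cup_r h {A B Z} {H : hom h unitK (ten A B)} :
  (idm A ⊗ braid Z B) ∘ (braid Z A ⊗ idm B) ∘ (idm Z ⊗ h) = h ⊗ idm Z.
Proof. rewrite <- (braid_split_r h), braid_K_r; diag. Qed.

Lemma braid_cap_r h {A B Z} {H : hom h (ten A B) unitK} :
  (h ⊗ idm Z) ∘ (idm A ⊗ braid Z B) ∘ (braid Z A ⊗ idm B) = idm Z ⊗ h.
Proof. rewrite <- (braid_merge_r h), braid_K_r; diag. Qed.

(** By [braid_cup_r] the cup on the right may be crossed over both legs; the inverse braiding then
    undoes the crossing with the second leg. *)
Lemma braidinv_cup h {A Z} {H : hom h unitK (ten A Z)} :
  (braid Z A ⊗ idm Z) ∘ (idm Z ⊗ h) = (idm A ⊗ braidinv Z Z) ∘ (h ⊗ idm Z).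
Proof.
symmetry; rewrite <- (braid_cup_r h).
via ((idm A ⊗ (braidinv Z Z ∘ braid Z Z)) ∘ (braid Z A ⊗ idm Z) ∘ (idm Z ⊗ h)).
rewrite braid_inv_l; diag.
Qed.

Lemma braidinv_merge h {A B C Z} {H : hom h (ten A B) C} :
  braidinv C Z ∘ (idm Z ⊗ h) =
  (h ⊗ idm Z) ∘ (idm A ⊗ braidinv B Z) ∘ (braidinv A Z ⊗ idm B).
Proof.
via (braidinv C Z ∘ (idm Z ⊗ h) ∘ idm (ten Z (ten A B))).
replace (idm (ten Z (ten A B))) with
  ((braid A Z ⊗ idm B) ∘ (idm A ⊗ (braid B Z ∘ braidinv B Z)) ∘
   (braidinv A Z ⊗ idm B)).
- via (braidinv C Z ∘ ((idm Z ⊗ h) ∘ (braid A Z ⊗ idm B) ∘ (idm A ⊗ braid B Z)) ∘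
       (idm A ⊗ braidinv B Z) ∘ (braidinv A Z ⊗ idm B)).
  rewrite <- (braid_merge_l h).
  via ((braidinv C Z ∘ braid C Z) ∘ (h ⊗ idm Z) ∘ (idm A ⊗ braidinv B Z) ∘
       (braidinv A Z ⊗ idm B)).
  rewrite braid_inv_l; diag.
- rewrite braid_inv_r.
  via ((braid A Z ∘ braidinv A Z) ⊗ idm B).
  rewrite braid_inv_r; diag.
Qed.
End Braiding.

#[local] Existing Instances braid_hom braidinv_hom.

(** * Weak Hopf algebras *)

Section WeakHopf.
Context {S : sbmcat} {B : Ob S} {eta mu eps delta lam : Mor S}.
Hypothesis HB : is_weak_hopf B eta mu eps delta lam.

Local Notation I := (idm B).
Local Notation c := (braid B B).
Local Notation c' := (braidinv B B).
Local Notation PiL := (PiL B eta mu eps delta).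
Local Notation PiR := (PiR B eta mu eps delta).

#[local] Instance hopf_eta_hom : hom eta unitK B. Proof. apply HB. Qed.
#[local] Instance hopf_mu_hom : hom mu (ten B B) B. Proof. apply HB. Qed.
#[local] Instance hopf_eps_hom : hom eps B unitK. Proof. apply HB. Qed.
#[local] Instance hopf_delta_hom : hom delta B (ten B B). Proof. apply HB. Qed.
#[local] Instance hopf_lam_hom : hom lam B B. Proof. apply HB. Qed.

#[local] Instance PiL_hom : hom PiL B B.
Proof. unfold Defs.PiL; diag_hom. Qed.

(** The counit slides through the crossing and removes one leg of [delta ∘ eta], leaving a product
    with the unit. *)
Lemma eps_PiL : eps ∘ PiL = eps.
Proof.
destruct HB as [[(_ & _ & _ & mu1 & _) [(_ & _ & _ & _ & eps1) _]] _].
unfold Defs.PiL.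
via ((eps ∘ mu) ∘ (I ⊗ ((I ⊗ eps) ∘ c)) ∘ ((delta ∘ eta) ⊗ I)).
rewrite <- (braid_slide_l eps), braid_K_l.
via (eps ∘ mu ∘ ((((I ⊗ eps) ∘ delta) ∘ eta) ⊗ I)).
rewrite eps1.
via (eps ∘ (mu ∘ (eta ⊗ I))).
rewrite mu1; diag.
Qed.

(** The form in which [PiR] emerges from the computation in [PiR_delta]. *)
Lemma PiR_eq : PiR = (I ⊗ (eps ∘ mu ∘ c')) ∘ ((delta ∘ eta) ⊗ I).
Proof.
unfold Defs.PiR.
via ((I ⊗ (eps ∘ mu)) ∘ ((c ⊗ I) ∘ (I ⊗ (delta ∘ eta)))).
rewrite (braidinv_cup (delta ∘ eta)); diag.
Qed.

(* The axiom for [(delta ⊗ id) ∘ delta ∘ eta] must be taken in the form with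
   [c'] here: the two crossings then cancel. *)
Lemma PiR_delta : (PiR ⊗ I) ∘ delta = (I ⊗ mu) ∘ (c ⊗ I) ∘ (I ⊗ (delta ∘ eta)).
Proof.
destruct HB as [[(_ & _ & muA & _ & mu1) [(_ & _ & deltaA & eps1 & _)
  (dm & _ & _ & _ & dm1)]] _].
symmetry.
via ((I ⊗ (I ∘ mu)) ∘ (c ⊗ I) ∘ (I ⊗ (delta ∘ eta))).
(* The second identity is the one composed with [mu]; expanding it by the counit law makes
   [delta ∘ mu] appear. *)
rewrite <- eps1 at 2.
via ((I ⊗ ((eps ⊗ I) ∘ (delta ∘ mu))) ∘ (c ⊗ I) ∘ (I ⊗ (delta ∘ eta))).
rewrite dm.
via ((I ⊗ (((eps ∘ mu) ⊗ mu) ∘ (I ⊗ c ⊗ I))) ∘ (((I ⊗ delta) ∘ c) ⊗ I ⊗ I)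
     ∘ (I ⊗ ((I ⊗ delta) ∘ delta ∘ eta))).
rewrite (braid_split_l delta), <- deltaA, dm1.
via ((I ⊗ (((eps ∘ mu) ⊗ mu))) ∘
     (I ⊗ I ⊗ (c ∘ (I ⊗ (mu ∘ c'))) ⊗ I) ∘
     (((c ⊗ I) ∘ (I ⊗ c)) ⊗ I ⊗ I ⊗ I) ∘
     (delta ⊗ (delta ∘ eta) ⊗ (delta ∘ eta))).
rewrite (braid_merge_r (mu ∘ c')).
via ((I ⊗ (((eps ∘ mu) ⊗ mu))) ∘
     (I ⊗ I ⊗ ((((mu ∘ c') ⊗ I) ∘ (I ⊗ c))) ⊗ I) ∘
     (c ⊗ I ⊗ I ⊗ I ⊗ I) ∘
     (I ⊗ ((I ⊗ c) ∘ (c ⊗ I) ∘ (I ⊗ (delta ∘ eta))) ⊗ (delta ∘ eta)) ∘ delta).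
rewrite (braid_cup_r (delta ∘ eta)).
via ((I ⊗ (((eps ∘ mu) ⊗ mu))) ∘
     (I ⊗ I ⊗ ((((mu ∘ c') ⊗ I) ∘ (I ⊗ c))) ⊗ I) ∘
     (((c ⊗ I) ∘ (I ⊗ (delta ∘ eta))) ⊗ I ⊗ I ⊗ I) ∘
     (I ⊗ I ⊗ (delta ∘ eta)) ∘ delta).
rewrite (braidinv_cup (delta ∘ eta)).
via ((I ⊗ (eps ∘ (mu ∘ (I ⊗ mu))) ⊗ mu) ∘
     (I ⊗ I ⊗ c' ⊗ I ⊗ I) ∘ (I ⊗ c' ⊗ c ⊗ I) ∘
     ((delta ∘ eta) ⊗ delta ⊗ (delta ∘ eta))).
rewrite <- muA.
via ((I ⊗ (eps ∘ mu ∘ ((mu ⊗ I) ∘ (I ⊗ c') ∘ (c' ⊗ I))) ⊗ mu) ∘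
     (I ⊗ I ⊗ I ⊗ c ⊗ I) ∘
     ((delta ∘ eta) ⊗ delta ⊗ (delta ∘ eta))).
rewrite <- (braidinv_merge mu).
via ((I ⊗ (eps ∘ mu ∘ c') ⊗ I) ∘
     ((delta ∘ eta) ⊗ ((mu ⊗ mu) ∘ (I ⊗ c ⊗ I) ∘ (delta ⊗ delta) ∘ (I ⊗ eta)))).
(* One copy of [delta ∘ eta] recombines with [delta] into the coproduct of a product with the unit,
   and so disappears. *)
rewrite <- dm.
via ((I ⊗ (eps ∘ mu ∘ c') ⊗ I) ∘
     ((delta ∘ eta) ⊗ (delta ∘ (mu ∘ (I ⊗ eta))))).
rewrite mu1, PiR_eq; diag.
Qed.

(** The coproduct reaches the unit inside [PiL]; the unbraided unit axiom splits the resulting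
    iterated coproduct into two copies of [delta ∘ eta], one rebuilding [PiL] and the other giving
    [1_1 ⊗ 1_2]. *)
Lemma PiL_coinvariant :
  delta ∘ PiL = (mu ⊗ I) ∘ (PiL ⊗ (delta ∘ eta)).
Proof.
destruct HB as [[_ [(_ & _ & deltaA & _) (_ & _ & _ & dm1 & _)]] _].
unfold Defs.PiL.
via (((eps ∘ mu) ⊗ I ⊗ I) ∘ (I ⊗ ((I ⊗ delta) ∘ c)) ∘ ((delta ∘ eta) ⊗ I)).
rewrite (braid_split_l delta).
via (((eps ∘ mu) ⊗ I ⊗ I) ∘ (I ⊗ ((c ⊗ I) ∘ (I ⊗ c))) ∘
     (((I ⊗ delta) ∘ delta ∘ eta) ⊗ I)).
rewrite <- deltaA, dm1.
via (((eps ∘ mu) ⊗ I ⊗ I) ∘ (I ⊗ (c ∘ (mu ⊗ I)) ⊗ I) ∘ (I ⊗ I ⊗ I ⊗ c) ∘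
     ((delta ∘ eta) ⊗ (delta ∘ eta) ⊗ I)).
rewrite (braid_merge_l mu).
via (((eps ∘ mu) ⊗ mu ⊗ I) ∘ (I ⊗ c ⊗ I ⊗ I) ∘
     (I ⊗ I ⊗ ((c ⊗ I) ∘ (I ⊗ c) ∘ ((delta ∘ eta) ⊗ I))) ∘ ((delta ∘ eta) ⊗ I)).
rewrite (braid_cup_l (delta ∘ eta)); diag.
Qed.

(** After multiplicativity of [delta], the unbraided counit axiom splits [eps(1_1 b_1 b'_1)] into
    [eps(1_1 b_1) eps(b_2 b'_1)]. The second factor is absorbed by the counit law. *)
Lemma PiL_linear :
  (PiL ⊗ I) ∘ delta ∘ mu = (I ⊗ mu) ∘ (((PiL ⊗ I) ∘ delta) ⊗ I).
Proof.
destruct HB as [[(_ & _ & muA & _) [(_ & _ & deltaA & eps1 & _)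
  (dm & em & _)]] _].
via ((PiL ⊗ I) ∘ (delta ∘ mu)).
rewrite dm; unfold Defs.PiL.
via (((eps ∘ mu) ⊗ I ⊗ I) ∘ (I ⊗ (c ∘ (I ⊗ mu)) ⊗ mu) ∘
     (I ⊗ I ⊗ I ⊗ c ⊗ I) ∘ ((delta ∘ eta) ⊗ delta ⊗ delta)).
rewrite (braid_merge_r mu).
via (((eps ∘ (mu ∘ (I ⊗ mu))) ⊗ I ⊗ I) ∘ (I ⊗ ((I ⊗ c) ∘ (c ⊗ I)) ⊗ mu) ∘
     (I ⊗ I ⊗ I ⊗ c ⊗ I) ∘ ((delta ∘ eta) ⊗ delta ⊗ delta)).
rewrite <- muA.
via (((eps ∘ mu ∘ (mu ⊗ I)) ⊗ I ⊗ I) ∘ (I ⊗ ((I ⊗ c) ∘ (c ⊗ I)) ⊗ mu) ∘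
     (I ⊗ I ⊗ I ⊗ c ⊗ I) ∘ ((delta ∘ eta) ⊗ delta ⊗ delta)).
rewrite em.
via (((eps ∘ mu) ⊗ (eps ∘ mu) ⊗ I ⊗ I) ∘ (I ⊗ I ⊗ I ⊗ c ⊗ I) ∘
     (I ⊗ ((delta ⊗ I) ∘ c) ⊗ I ⊗ mu) ∘
     (I ⊗ I ⊗ I ⊗ c ⊗ I) ∘ ((delta ∘ eta) ⊗ delta ⊗ delta)).
rewrite (braid_split_r delta).
via (((eps ∘ mu) ⊗ (((eps ∘ mu) ⊗ I) ∘ (I ⊗ c) ∘ (c ⊗ I)) ⊗ mu) ∘
     (I ⊗ c ⊗ I ⊗ c ⊗ I) ∘
     ((delta ∘ eta) ⊗ ((delta ⊗ I) ∘ delta) ⊗ delta)).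
rewrite (braid_cap_r (eps ∘ mu)), deltaA.
via (((eps ∘ mu) ⊗ I ⊗ I) ∘ (I ⊗ c ⊗ ((eps ⊗ I) ∘ ((mu ⊗ mu) ∘
     (I ⊗ c ⊗ I) ∘ (delta ⊗ delta)))) ∘ ((delta ∘ eta) ⊗ delta ⊗ I)).
rewrite <- dm.
via (((eps ∘ mu) ⊗ I ⊗ I) ∘ (I ⊗ c ⊗ (((eps ⊗ I) ∘ delta) ∘ mu)) ∘
     ((delta ∘ eta) ⊗ delta ⊗ I)).
rewrite eps1; diag.
Qed.

(** Up to braidings: [lam(b_2)_1 ⊗ b_1 lam(b_2)_2 = lam(b) 1_1 ⊗ 1_2]. Writing [lam] as
    [lam * id * lam] turns the right side into [PiR(b_1) lam(b_3)_1 ⊗ b_2 lam(b_3)_2], and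
    [PiR_delta] replaces [PiR(b_1) ⊗ b_2] by [1_1 ⊗ b 1_2]. *)
Lemma antipode_coinvariant :
  (I ⊗ mu) ∘ (c ⊗ I) ∘ (I ⊗ (delta ∘ lam)) ∘ delta =
  (mu ⊗ I) ∘ (lam ⊗ (delta ∘ eta)).
Proof.
destruct HB as [[(_ & _ & muA & mu1 & _) [(_ & _ & deltaA & _) (dm & _)]]
  (_ & lL & lR & lll)].
symmetry; rewrite <- lll at 1; unfold conv in *.
via ((mu ⊗ I) ∘ (mu ⊗ I ⊗ I) ∘ (mu ⊗ I ⊗ I ⊗ I) ∘
     (((lam ⊗ I ⊗ lam) ∘ ((delta ⊗ I) ∘ delta)) ⊗ (delta ∘ eta))).
rewrite deltaA.
via (((mu ∘ (mu ⊗ I)) ⊗ I) ∘ (mu ⊗ I ⊗ I ⊗ I) ∘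
     (((lam ⊗ I ⊗ lam) ∘ ((I ⊗ delta) ∘ delta)) ⊗ (delta ∘ eta))).
rewrite muA.
via (((mu ∘ (mu ⊗ I)) ⊗ I) ∘ (I ⊗ I ⊗ mu ⊗ I) ∘
     (((lam ⊗ I ⊗ lam) ∘ ((I ⊗ delta) ∘ delta)) ⊗ (delta ∘ eta))).
rewrite muA.
(* [PiL_coinvariant] with [PiL] written as [id * lam]. *)
assert (E : (mu ⊗ I) ∘ ((mu ∘ (I ⊗ lam) ∘ delta) ⊗ (delta ∘ eta)) =
            (delta ∘ mu) ∘ (I ⊗ lam) ∘ delta).
{ rewrite lL, <- PiL_coinvariant, <- lL; diag. }
via ((mu ⊗ I) ∘ (lam ⊗ ((mu ∘ (I ⊗ mu)) ⊗ I)) ∘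
     (I ⊗ ((I ⊗ lam) ∘ delta) ⊗ (delta ∘ eta)) ∘ delta).
rewrite <- muA.
via ((mu ⊗ I) ∘ (lam ⊗ ((mu ⊗ I) ∘ ((mu ∘ (I ⊗ lam) ∘ delta) ⊗ (delta ∘ eta)))) ∘
     delta).
rewrite E, dm.
via ((mu ⊗ I) ∘ (lam ⊗ ((mu ⊗ mu) ∘ (I ⊗ c ⊗ I) ∘ (I ⊗ I ⊗ (delta ∘ lam)))) ∘
     (I ⊗ delta ⊗ I) ∘ ((I ⊗ delta) ∘ delta)).
rewrite <- deltaA.
via (((mu ∘ (I ⊗ mu)) ⊗ mu) ∘ (lam ⊗ I ⊗ c ⊗ I) ∘
     (((I ⊗ delta) ∘ delta) ⊗ (delta ∘ lam)) ∘ delta).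
rewrite <- muA, <- deltaA.
via ((mu ⊗ mu) ∘ (I ⊗ c ⊗ I) ∘
     ((((mu ∘ (lam ⊗ I) ∘ delta) ⊗ I) ∘ delta) ⊗ (delta ∘ lam)) ∘ delta).
rewrite lR, PiR_delta.
via ((mu ⊗ mu) ∘ (I ⊗ (c ∘ (mu ⊗ I)) ⊗ I) ∘ (c ⊗ I ⊗ I ⊗ I) ∘
     (I ⊗ (delta ∘ eta) ⊗ (delta ∘ lam)) ∘ delta).
rewrite (braid_merge_l mu).
via ((mu ⊗ (mu ∘ (mu ⊗ I))) ∘ (I ⊗ c ⊗ I ⊗ I) ∘ (c ⊗ c ⊗ I) ∘
     (I ⊗ (delta ∘ eta) ⊗ (delta ∘ lam)) ∘ delta).
rewrite muA.
via ((I ⊗ mu) ∘ (((mu ⊗ I) ∘ (I ⊗ c) ∘ (c ⊗ I)) ⊗ I) ∘ (I ⊗ I ⊗ I ⊗ mu) ∘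
     (I ⊗ I ⊗ c ⊗ I) ∘ (I ⊗ (delta ∘ eta) ⊗ (delta ∘ lam)) ∘ delta).
rewrite <- (braid_merge_r mu).
via ((I ⊗ mu) ∘ (c ⊗ I) ∘
     (I ⊗ ((mu ⊗ mu) ∘ (I ⊗ c ⊗ I) ∘ (delta ⊗ delta) ∘ (eta ⊗ lam))) ∘ delta).
rewrite <- dm.
via ((I ⊗ mu) ∘ (c ⊗ I) ∘ (I ⊗ (delta ∘ (mu ∘ (eta ⊗ I)) ∘ lam)) ∘ delta).
rewrite mu1; diag.
Qed.
End WeakHopf.

#[local] Existing Instances idm_hom tenm_hom PiL_hom.

(** * Weak projections *)

Section WeakProjection.
Context {S : sbmcat} {D B C : Ob S}
  {etaD muD epsD deltaD etaB muB epsB deltaB lam f g i p : Mor S}.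
Hypothesis HP :
  is_weak_projection D etaD muD epsD deltaD B etaB muB epsB deltaB lam f g.
Hypothesis i_dom_cod : hom i C D.
Hypothesis p_dom_cod : hom p D C.
Hypothesis ip : i ∘ p = muD ∘ (idm D ⊗ (f ∘ lam ∘ g)) ∘ deltaD.
Hypothesis pi : p ∘ i = idm C.

Local Notation ID := (idm D).
Local Notation IB := (idm B).
Local Notation IC := (idm C).
Local Notation deltaC := ((p ⊗ p) ∘ deltaD ∘ i).
Local Notation epsC := (epsD ∘ i).
Local Notation w := (muD ∘ (i ⊗ f)).
Local Notation w' := ((p ⊗ g) ∘ deltaD).
Local Notation psi := ((p ⊗ g) ∘ deltaD ∘ muD ∘ (f ⊗ i)).
Local Notation sigma := ((p ⊗ g) ∘ deltaD ∘ muD ∘ (i ⊗ i)).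
Local Notation chi := ((g ⊗ p) ∘ deltaD ∘ muD ∘ (i ⊗ f)).
Local Notation tau := ((g ⊗ g) ∘ deltaD ∘ muD ∘ (i ⊗ f)).
Local Notation nu := ((p ⊗ g) ∘ deltaD ∘ etaD).
Local Notation ups := (epsD ∘ muD ∘ (i ⊗ f)).
Local Notation PiL := (PiL B etaB muB epsB deltaB).

#[local] Instance etaD_hom : hom etaD unitK D. Proof. apply HP. Qed.
#[local] Instance muD_hom : hom muD (ten D D) D. Proof. apply HP. Qed.
#[local] Instance epsD_hom : hom epsD D unitK. Proof. apply HP. Qed.
#[local] Instance deltaD_hom : hom deltaD D (ten D D). Proof. apply HP. Qed.
#[local] Instance etaB_hom : hom etaB unitK B. Proof. apply HP. Qed.
#[local] Instance muB_hom : hom muB (ten B B) B. Proof. apply HP. Qed.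
#[local] Instance epsB_hom : hom epsB B unitK. Proof. apply HP. Qed.
#[local] Instance deltaB_hom : hom deltaB B (ten B B). Proof. apply HP. Qed.
#[local] Instance lam_hom : hom lam B B. Proof. apply HP. Qed.
#[local] Instance f_hom : hom f B D. Proof. apply HP. Qed.
#[local] Instance g_hom : hom g D B. Proof. apply HP. Qed.
#[local] Instance i_hom : hom i C D. Proof. exact i_dom_cod. Qed.
#[local] Instance p_hom : hom p D C. Proof. exact p_dom_cod. Qed.

Let HB : is_weak_hopf B etaB muB epsB deltaB lam. Proof. apply HP. Qed.
#[local] Instance PiLB_hom : hom PiL B B. Proof. exact (PiL_hom HB). Qed.

Lemma muD_assoc : muD ∘ (muD ⊗ ID) = muD ∘ (ID ⊗ muD). Proof. apply HP. Qed.
Lemma muD_unit_l : muD ∘ (etaD ⊗ ID) = ID. Proof. apply HP. Qed.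
Lemma muD_unit_r : muD ∘ (ID ⊗ etaD) = ID. Proof. apply HP. Qed.
Lemma deltaD_assoc : (deltaD ⊗ ID) ∘ deltaD = (ID ⊗ deltaD) ∘ deltaD.
Proof. apply HP. Qed.
Lemma deltaD_unit_l : (epsD ⊗ ID) ∘ deltaD = ID. Proof. apply HP. Qed.
Lemma deltaD_unit_r : (ID ⊗ epsD) ∘ deltaD = ID. Proof. apply HP. Qed.
Lemma deltaD_muD :
  deltaD ∘ muD = (muD ⊗ muD) ∘ (ID ⊗ braid D D ⊗ ID) ∘ (deltaD ⊗ deltaD).
Proof. apply HP. Qed.
Lemma f_eta : f ∘ etaB = etaD. Proof. apply HP. Qed.
Lemma f_mu : f ∘ muB = muD ∘ (f ⊗ f). Proof. apply HP. Qed.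
Lemma f_delta : deltaD ∘ f = (f ⊗ f) ∘ deltaB. Proof. apply HP. Qed.
Lemma g_delta : deltaB ∘ g = (g ⊗ g) ∘ deltaD. Proof. apply HP. Qed.
Lemma g_eps : epsB ∘ g = epsD. Proof. apply HP. Qed.
Lemma gf : g ∘ f = IB. Proof. apply HP. Qed.
Lemma g_linear : g ∘ muD ∘ (ID ⊗ f) = muB ∘ (g ⊗ IB). Proof. apply HP. Qed.

(** * The splitting of [w] and the right coaction of [B] on [D] *)

(** Multiplicativity of [f] collects [lam * id] into [PiR]. Linearity of [g] turns [epsB(g(d) b)]
    into [epsD(d f(b))], after which everything is the coproduct of [d 1] followed by the counit. *)
Lemma w_section : w ∘ w' = ID.
Proof.
destruct HB as [_ (_ & _ & lR & _)]; unfold conv in lR.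
via (muD ∘ ((i ∘ p) ⊗ (f ∘ g)) ∘ deltaD).
rewrite ip.
via (muD ∘ (muD ⊗ ID) ∘ (ID ⊗ (f ∘ lam ∘ g) ⊗ (f ∘ g)) ∘ ((deltaD ⊗ ID) ∘ deltaD)).
rewrite muD_assoc, deltaD_assoc.
via (muD ∘ (ID ⊗ ((muD ∘ (f ⊗ f)) ∘ (lam ⊗ IB) ∘ ((g ⊗ g) ∘ deltaD))) ∘ deltaD).
rewrite <- f_mu, <- g_delta.
via (muD ∘ (ID ⊗ (f ∘ (muB ∘ (lam ⊗ IB) ∘ deltaB) ∘ g)) ∘ deltaD).
rewrite lR; unfold PiR.
via (muD ∘ (ID ⊗ f ⊗ (epsB ∘ muB)) ∘ (ID ⊗ (braid B B ∘ (g ⊗ IB)) ⊗ IB) ∘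
     (deltaD ⊗ (deltaB ∘ etaB))).
rewrite (braid_slide_l g).
via (muD ∘ (ID ⊗ f ⊗ (epsB ∘ (muB ∘ (g ⊗ IB)))) ∘ (ID ⊗ braid D B ⊗ IB) ∘
     (deltaD ⊗ (deltaB ∘ etaB))).
rewrite <- g_linear.
via (muD ∘ (ID ⊗ ID ⊗ ((epsB ∘ g) ∘ muD)) ∘ (ID ⊗ ((f ⊗ ID) ∘ braid D B) ⊗ f) ∘
     (deltaD ⊗ (deltaB ∘ etaB))).
rewrite <- (braid_slide_r f), g_eps.
via ((ID ⊗ epsD) ∘ (muD ⊗ muD) ∘ (ID ⊗ braid D D ⊗ ID) ∘
     (deltaD ⊗ (((f ⊗ f) ∘ deltaB) ∘ etaB))).
rewrite <- f_delta.
via ((ID ⊗ epsD) ∘ ((muD ⊗ muD) ∘ (ID ⊗ braid D D ⊗ ID) ∘ (deltaD ⊗ deltaD)) ∘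
     (ID ⊗ (f ∘ etaB))).
rewrite <- deltaD_muD, f_eta.
via (((ID ⊗ epsD) ∘ deltaD) ∘ (muD ∘ (ID ⊗ etaD))).
rewrite deltaD_unit_r, muD_unit_r; diag.
Qed.

Lemma coaction_mul :
  (ID ⊗ g) ∘ deltaD ∘ muD ∘ (ID ⊗ f) =
  ((muD ∘ (ID ⊗ f)) ⊗ muB) ∘ (ID ⊗ braid B B ⊗ IB) ∘
  (((ID ⊗ g) ∘ deltaD) ⊗ deltaB).
Proof.
via ((ID ⊗ g) ∘ (deltaD ∘ muD) ∘ (ID ⊗ f)).
rewrite deltaD_muD.
via ((muD ⊗ (g ∘ muD)) ∘ (ID ⊗ braid D D ⊗ ID) ∘ (deltaD ⊗ (deltaD ∘ f))).
rewrite f_delta.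
via ((muD ⊗ (g ∘ muD ∘ (ID ⊗ f))) ∘ (ID ⊗ (braid D D ∘ (ID ⊗ f)) ⊗ IB) ∘
     (deltaD ⊗ deltaB)).
rewrite g_linear, (braid_slide_r f).
via (((muD ∘ (ID ⊗ f)) ⊗ muB) ∘ (ID ⊗ ((IB ⊗ g) ∘ braid D B) ⊗ IB) ∘
     (deltaD ⊗ deltaB)).
rewrite <- (braid_slide_l g); diag.
Qed.

(** The image of [i] is coinvariant because [antipode_coinvariant] says the analogous thing about
    [lam]. It is proved first for [i ∘ p], where the formula for [t] is available, and then composed
    with [i]. *)
Lemma coaction_i :
  (ID ⊗ g) ∘ deltaD ∘ i = (muD ⊗ IB) ∘ (i ⊗ ((f ⊗ IB) ∘ deltaB ∘ etaB)).
Proof.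
assert (E : (ID ⊗ g) ∘ deltaD ∘ (i ∘ p) =
            (muD ⊗ IB) ∘ ((i ∘ p) ⊗ ((f ⊗ IB) ∘ deltaB ∘ etaB))).
{ rewrite ip.
  via ((ID ⊗ g) ∘ deltaD ∘ muD ∘ (ID ⊗ f) ∘ (ID ⊗ (lam ∘ g)) ∘ deltaD).
  rewrite coaction_mul.
  via (((muD ∘ (ID ⊗ f)) ⊗ muB) ∘ (ID ⊗ braid B B ⊗ IB) ∘
       (ID ⊗ g ⊗ (deltaB ∘ lam ∘ g)) ∘ ((deltaD ⊗ ID) ∘ deltaD)).
  rewrite deltaD_assoc.
  via ((muD ⊗ IB) ∘ (ID ⊗ ((f ⊗ IB) ∘ (IB ⊗ muB) ∘ (braid B B ⊗ IB) ∘
       (IB ⊗ (deltaB ∘ lam)) ∘ ((g ⊗ g) ∘ deltaD))) ∘ deltaD).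
  rewrite <- g_delta.
  via ((muD ⊗ IB) ∘ (ID ⊗ ((f ⊗ IB) ∘ ((IB ⊗ muB) ∘ (braid B B ⊗ IB) ∘
       (IB ⊗ (deltaB ∘ lam)) ∘ deltaB) ∘ g)) ∘ deltaD).
  rewrite (antipode_coinvariant HB).
  via ((muD ⊗ IB) ∘ (ID ⊗ (f ∘ muB) ⊗ IB) ∘
       (ID ⊗ (lam ∘ g) ⊗ (deltaB ∘ etaB)) ∘ deltaD).
  rewrite f_mu.
  via (((muD ∘ (ID ⊗ muD)) ⊗ IB) ∘
       (ID ⊗ (f ∘ lam ∘ g) ⊗ ((f ⊗ IB) ∘ deltaB ∘ etaB)) ∘ deltaD).
  rewrite <- muD_assoc; diag. }
via ((ID ⊗ g) ∘ deltaD ∘ i ∘ IC).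
rewrite <- pi.
via ((ID ⊗ g) ∘ deltaD ∘ (i ∘ p) ∘ i).
rewrite E.
via ((muD ⊗ IB) ∘ ((i ∘ (p ∘ i)) ⊗ ((f ⊗ IB) ∘ deltaB ∘ etaB))).
rewrite pi; diag.
Qed.

(** The factor [1_1 ⊗ 1_2] from [coaction_i] is absorbed by [deltaB], since [1_1 b_1 ⊗ 1_2 b_2] is
    the coproduct of [1 b]. *)
Lemma coaction_w : (ID ⊗ g) ∘ deltaD ∘ w = (w ⊗ IB) ∘ (IC ⊗ deltaB).
Proof.
destruct HB as [[(_ & _ & _ & mu1 & _) [_ (dm & _)]] _].
via ((ID ⊗ g) ∘ deltaD ∘ muD ∘ (ID ⊗ f) ∘ (i ⊗ IB)).
rewrite coaction_mul.
via (((muD ∘ (ID ⊗ f)) ⊗ muB) ∘ (ID ⊗ braid B B ⊗ IB) ∘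
     (((ID ⊗ g) ∘ deltaD ∘ i) ⊗ deltaB)).
rewrite coaction_i.
via (((muD ∘ (muD ⊗ ID)) ⊗ IB) ∘
     (i ⊗ ((f ⊗ f ⊗ muB) ∘ (IB ⊗ braid B B ⊗ IB) ∘ ((deltaB ∘ etaB) ⊗ deltaB)))).
rewrite muD_assoc.
via ((muD ⊗ IB) ∘
     (i ⊗ (((muD ∘ (f ⊗ f)) ⊗ muB) ∘ (IB ⊗ braid B B ⊗ IB) ∘
           ((deltaB ∘ etaB) ⊗ deltaB)))).
rewrite <- f_mu.
via ((muD ⊗ IB) ∘ (i ⊗ ((f ⊗ IB) ∘ ((muB ⊗ muB) ∘ (IB ⊗ braid B B ⊗ IB) ∘
     (deltaB ⊗ deltaB)) ∘ (etaB ⊗ IB)))).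
rewrite <- dm.
via ((muD ⊗ IB) ∘ (i ⊗ ((f ⊗ IB) ∘ deltaB ∘ (muB ∘ (etaB ⊗ IB))))).
rewrite mu1; diag.
Qed.

Lemma ip_w : i ∘ p ∘ w = muD ∘ (i ⊗ (f ∘ PiL)).
Proof.
destruct HB as [_ (_ & lL & _)]; unfold conv in lL.
rewrite ip.
via (muD ∘ (ID ⊗ (f ∘ lam)) ∘ ((ID ⊗ g) ∘ deltaD ∘ w)).
rewrite coaction_w.
via ((muD ∘ (muD ⊗ ID)) ∘ (i ⊗ ((f ⊗ f) ∘ (IB ⊗ lam) ∘ deltaB))).
rewrite muD_assoc.
via (muD ∘ (i ⊗ ((muD ∘ (f ⊗ f)) ∘ (IB ⊗ lam) ∘ deltaB))).
rewrite <- f_mu, <- lL; diag.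
Qed.

Lemma nabla_eq :
  w' ∘ w = ((p ∘ muD) ⊗ IB) ∘ (i ⊗ ((f ⊗ IB) ∘ ((PiL ⊗ IB) ∘ deltaB))).
Proof.
via (((IC ∘ p) ⊗ IB) ∘ ((ID ⊗ g) ∘ deltaD ∘ w)).
(* [p] becomes [p ∘ i ∘ p], which prepares for [ip_w]. *)
rewrite <- pi, coaction_w.
via ((p ⊗ IB) ∘ ((i ∘ p ∘ w) ⊗ IB) ∘ (IC ⊗ deltaB)).
rewrite ip_w; diag.
Qed.

Lemma nabla_linear : w' ∘ w ∘ (IC ⊗ muB) = (IC ⊗ muB) ∘ ((w' ∘ w) ⊗ IB).
Proof.
rewrite nabla_eq.
via (((p ∘ muD) ⊗ IB) ∘ (i ⊗ ((f ⊗ IB) ∘ ((PiL ⊗ IB) ∘ deltaB ∘ muB)))).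
rewrite (PiL_linear HB); diag.
Qed.

Lemma w'_linear : w' ∘ muD ∘ (ID ⊗ f) = (IC ⊗ muB) ∘ (w' ⊗ IB).
Proof.
via (w' ∘ muD ∘ (ID ⊗ f) ∘ (ID ⊗ IB)).
(* The second identity is the appended one; as [w ∘ w'] it reduces the claim to [nabla_linear]. *)
rewrite <- w_section at 2.
via (w' ∘ (muD ∘ (muD ⊗ ID)) ∘ (i ⊗ f ⊗ f) ∘ (w' ⊗ IB)).
rewrite muD_assoc.
via (w' ∘ muD ∘ (i ⊗ (muD ∘ (f ⊗ f))) ∘ (w' ⊗ IB)).
rewrite <- f_mu.
via (w' ∘ w ∘ (IC ⊗ muB) ∘ (w' ⊗ IB)).
rewrite nabla_linear.
via ((IC ⊗ muB) ∘ ((w' ∘ (w ∘ w')) ⊗ IB)).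
rewrite w_section; diag.
Qed.

(** * The coalgebra of coinvariants *)

(** Linearity of [g] moves the formula for [t] into [B], where [id * lam] is [PiL] and [eps_PiL]
    applies. *)
Lemma eps_ip : epsD ∘ i ∘ p = epsD.
Proof.
destruct HB as [_ (_ & lL & _)]; unfold conv in lL.
via (epsD ∘ (i ∘ p)).
rewrite ip, <- g_eps.
via (epsB ∘ (g ∘ muD ∘ (ID ⊗ f)) ∘ (ID ⊗ (lam ∘ g)) ∘ deltaD).
rewrite g_linear.
via (epsB ∘ muB ∘ (IB ⊗ lam) ∘ ((g ⊗ g) ∘ deltaD)).
rewrite <- g_delta.
via (epsB ∘ (muB ∘ (IB ⊗ lam) ∘ deltaB) ∘ g).
rewrite lL, (eps_PiL HB); diag.
Qed.

Lemma p_mul : p ∘ muD ∘ (ID ⊗ f) = (p ⊗ (epsD ∘ muD ∘ (ID ⊗ f))) ∘ (deltaD ⊗ IB).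
Proof.
via (p ∘ ID ∘ muD ∘ (ID ⊗ f)).
(* The counit of [D] is inserted and written as [epsB ∘ g], so that [w'] appears. *)
rewrite <- deltaD_unit_r at 1; rewrite <- g_eps.
via ((IC ⊗ epsB) ∘ (w' ∘ muD ∘ (ID ⊗ f))).
rewrite w'_linear.
via ((p ⊗ (epsB ∘ (muB ∘ (g ⊗ IB)))) ∘ (deltaD ⊗ IB)).
rewrite <- g_linear; diag.
Qed.

(** By [p_mul] the left side is [p(d_1) epsD(d_2 f(b_1)) ⊗ d_3 f(b_2)], where the counit cancels
    against the coproduct of [d_2 f(b)]. *)
Lemma p_comul_mul :
  (p ⊗ ID) ∘ deltaD ∘ muD ∘ (ID ⊗ f) = (p ⊗ (muD ∘ (ID ⊗ f))) ∘ (deltaD ⊗ IB).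
Proof.
via ((p ⊗ ID) ∘ (deltaD ∘ muD) ∘ (ID ⊗ f)).
rewrite deltaD_muD.
via (((p ∘ muD) ⊗ muD) ∘ (ID ⊗ braid D D ⊗ ID) ∘ (deltaD ⊗ (deltaD ∘ f))).
rewrite f_delta.
via (((p ∘ muD) ⊗ (muD ∘ (ID ⊗ f))) ∘ (ID ⊗ (braid D D ∘ (ID ⊗ f)) ⊗ IB) ∘
     (deltaD ⊗ deltaB)).
rewrite (braid_slide_r f).
via (((p ∘ muD ∘ (ID ⊗ f)) ⊗ (muD ∘ (ID ⊗ f))) ∘ (ID ⊗ braid D B ⊗ IB) ∘
     (deltaD ⊗ deltaB)).
rewrite p_mul.
via ((p ⊗ (epsD ∘ muD ∘ (ID ⊗ f)) ⊗ (muD ∘ (ID ⊗ f))) ∘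
     (ID ⊗ ID ⊗ braid D B ⊗ IB) ∘ (((deltaD ⊗ ID) ∘ deltaD) ⊗ deltaB)).
rewrite deltaD_assoc.
via ((p ⊗ (epsD ∘ muD) ⊗ muD) ∘ (ID ⊗ ID ⊗ ((f ⊗ ID) ∘ braid D B) ⊗ f) ∘
     (((ID ⊗ deltaD) ∘ deltaD) ⊗ deltaB)).
rewrite <- (braid_slide_r f).
via ((p ⊗ (epsD ∘ muD) ⊗ muD) ∘ (ID ⊗ ID ⊗ braid D D ⊗ ID) ∘
     (((ID ⊗ deltaD) ∘ deltaD) ⊗ ((f ⊗ f) ∘ deltaB))).
rewrite <- f_delta.
via ((p ⊗ ((epsD ⊗ ID) ∘ ((muD ⊗ muD) ∘ (ID ⊗ braid D D ⊗ ID) ∘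
     (deltaD ⊗ deltaD)))) ∘ (deltaD ⊗ f)).
rewrite <- deltaD_muD.
via ((p ⊗ (((epsD ⊗ ID) ∘ deltaD) ∘ muD)) ∘ (deltaD ⊗ f)).
rewrite deltaD_unit_l; diag.
Qed.

Lemma p_comul_ip : (p ⊗ ID) ∘ deltaD ∘ (i ∘ p) = (p ⊗ (i ∘ p)) ∘ deltaD.
Proof.
rewrite ip.
via ((p ⊗ ID) ∘ deltaD ∘ muD ∘ (ID ⊗ f) ∘ (ID ⊗ (lam ∘ g)) ∘ deltaD).
rewrite p_comul_mul.
via ((p ⊗ muD) ∘ (ID ⊗ ID ⊗ (f ∘ lam ∘ g)) ∘ ((deltaD ⊗ ID) ∘ deltaD)).
rewrite deltaD_assoc; diag.
Qed.

Lemma p_comul : deltaC ∘ p = (p ⊗ p) ∘ deltaD.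
Proof.
via ((IC ⊗ p) ∘ ((p ⊗ ID) ∘ deltaD ∘ (i ∘ p))).
rewrite p_comul_ip.
via ((p ⊗ ((p ∘ i) ∘ p)) ∘ deltaD).
rewrite pi; diag.
Qed.

Lemma C_coalgebra : is_coalgebra C deltaC epsC.
Proof.
split; [diag_hom | split; [diag_hom | split; [| split]]].
- via ((((deltaC ∘ p) ⊗ p) ∘ deltaD) ∘ i).
  rewrite p_comul.
  via ((p ⊗ p ⊗ p) ∘ ((deltaD ⊗ ID) ∘ deltaD) ∘ i).
  rewrite deltaD_assoc; symmetry.
  via ((p ⊗ (deltaC ∘ p)) ∘ deltaD ∘ i).
  rewrite p_comul; diag.
- via (((epsD ∘ i ∘ p) ⊗ p) ∘ deltaD ∘ i).
  rewrite eps_ip.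
  via (p ∘ ((epsD ⊗ ID) ∘ deltaD) ∘ i).
  rewrite deltaD_unit_l, <- pi; diag.
- via ((p ⊗ (epsD ∘ i ∘ p)) ∘ deltaD ∘ i).
  rewrite eps_ip.
  via (p ∘ ((ID ⊗ epsD) ∘ deltaD) ∘ i).
  rewrite deltaD_unit_r, <- pi; diag.
Qed.

Lemma w_colinear : (IC ⊗ w) ∘ (deltaC ⊗ IB) = (p ⊗ ID) ∘ deltaD ∘ w.
Proof.
via ((IC ⊗ (muD ∘ (ID ⊗ f))) ∘ (((p ⊗ (i ∘ p)) ∘ deltaD ∘ i) ⊗ IB)).
rewrite <- p_comul_ip.
via ((IC ⊗ (muD ∘ (ID ⊗ f))) ∘ (((p ⊗ ID) ∘ deltaD ∘ (i ∘ (p ∘ i))) ⊗ IB)).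
rewrite pi; symmetry.
via ((p ⊗ ID) ∘ deltaD ∘ muD ∘ (ID ⊗ f) ∘ (i ⊗ IB)).
rewrite p_comul_mul; diag.
Qed.

(** * The weak crossed product *)

(** With [h] left free, one statement covers both [psi] ([h = f]) and [sigma] ([h = i]). *)
Lemma psi_act h {X} {H : hom h X D} :
  (IC ⊗ muB) ∘ ((w' ∘ muD ∘ (h ⊗ i)) ⊗ IB) = w' ∘ muD ∘ (h ⊗ w).
Proof.
via ((IC ⊗ muB) ∘ (w' ⊗ IB) ∘ ((muD ∘ (h ⊗ i)) ⊗ IB)).
rewrite <- w'_linear.
via (w' ∘ (muD ∘ (muD ⊗ ID)) ∘ (h ⊗ i ⊗ f)).
rewrite muD_assoc; diag.
Qed.

Lemma act_w' h k {X Y} {H : hom h X D} {H' : hom k Y D} :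
  (IC ⊗ muB) ∘ ((w' ∘ muD ∘ (h ⊗ i)) ⊗ IB) ∘ (idm X ⊗ (w' ∘ k)) =
  w' ∘ muD ∘ (h ⊗ k).
Proof.
rewrite (psi_act h).
via (w' ∘ muD ∘ (h ⊗ ((w ∘ w') ∘ k))).
rewrite w_section; diag.
Qed.

(** Serves the twisted, cocycle and first preunit conditions: [psi], [sigma] and [nu] are all of the
    form [w' ∘ h]. *)
Lemma sigma_psi h {X} {H : hom h X D} :
  (IC ⊗ muB) ∘ (sigma ⊗ IB) ∘ (IC ⊗ psi) ∘ ((w' ∘ h) ⊗ IC) =
  w' ∘ muD ∘ (h ⊗ i).
Proof.
rewrite (psi_act i).
via (w' ∘ muD ∘ (i ⊗ ((w ∘ w') ∘ muD ∘ (f ⊗ i))) ∘ ((w' ∘ h) ⊗ IC)).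
rewrite w_section.
via (w' ∘ (muD ∘ (ID ⊗ muD)) ∘ (i ⊗ f ⊗ i) ∘ ((w' ∘ h) ⊗ IC)).
rewrite <- muD_assoc.
via (w' ∘ muD ∘ (((w ∘ w') ∘ h) ⊗ i)).
rewrite w_section; diag.
Qed.

Lemma nablaP_eq : nablaP C B etaB muB psi = w' ∘ w.
Proof.
unfold nablaP.
via ((IC ⊗ muB) ∘ (psi ⊗ IB) ∘ (etaB ⊗ IC ⊗ IB)).
rewrite (psi_act f).
via (w' ∘ muD ∘ ((f ∘ etaB) ⊗ w)).
rewrite f_eta.
via (w' ∘ (muD ∘ (etaD ⊗ ID)) ∘ w).
rewrite muD_unit_l; diag.
Qed.

Lemma betaP_eq : betaP C B muB nu = w' ∘ f.
Proof.
unfold betaP.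
via ((IC ⊗ muB) ∘ (w' ⊗ IB) ∘ (etaD ⊗ IB)).
rewrite <- w'_linear.
via (w' ∘ (muD ∘ (etaD ⊗ ID)) ∘ f).
rewrite muD_unit_l; diag.
Qed.

Lemma muP_eq : muP C B muB psi sigma = w' ∘ muD ∘ (w ⊗ w).
Proof.
unfold muP.
via ((IC ⊗ muB) ∘ (sigma ⊗ IB) ∘ (IC ⊗ ((IC ⊗ muB) ∘ (psi ⊗ IB)))).
rewrite (psi_act i), (psi_act f).
via (w' ∘ muD ∘ (i ⊗ ((w ∘ w') ∘ muD ∘ (f ⊗ w)))).
rewrite w_section.
via (w' ∘ (muD ∘ (ID ⊗ muD)) ∘ (i ⊗ f ⊗ w)).
rewrite <- muD_assoc; diag.
Qed.

(** The product conditions become associativity or unit laws of [D] followed by [w']; those on the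
    idempotent come from [w_section]. *)
Lemma crossed_product :
  is_weak_crossed_product_preunit C B etaB muB psi sigma nu.
Proof.
unfold is_weak_crossed_product_preunit; rewrite nablaP_eq, betaP_eq.
split; [diag_hom | split; [diag_hom | split; [diag_hom |]]].
split; [| split; [| split; [| split; [| split; [| split; [| split]]]]]].
- via ((IC ⊗ muB) ∘ (psi ⊗ IB) ∘ (IB ⊗ (w' ∘ (muD ∘ (f ⊗ i))))).
  rewrite (act_w' f (muD ∘ (f ⊗ i))).
  via (w' ∘ (muD ∘ (ID ⊗ muD)) ∘ (f ⊗ f ⊗ i)).
  rewrite <- muD_assoc.
  via (w' ∘ muD ∘ ((muD ∘ (f ⊗ f)) ⊗ i)).
  rewrite <- f_mu; diag.
- via (w' ∘ (w ∘ w') ∘ w).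
  rewrite w_section; diag.
- via (w' ∘ (w ∘ w') ∘ muD ∘ (i ⊗ i)).
  rewrite w_section; diag.
- via ((IC ⊗ muB) ∘ (sigma ⊗ IB) ∘ (IC ⊗ psi) ∘ ((w' ∘ (muD ∘ (f ⊗ i))) ⊗ IC)).
  rewrite (sigma_psi (muD ∘ (f ⊗ i))); symmetry.
  via ((IC ⊗ muB) ∘ (psi ⊗ IB) ∘ (IB ⊗ (w' ∘ (muD ∘ (i ⊗ i))))).
  rewrite (act_w' f (muD ∘ (i ⊗ i))).
  via (w' ∘ (muD ∘ (ID ⊗ muD)) ∘ (f ⊗ i ⊗ i)).
  rewrite <- muD_assoc; diag.
- symmetry.
  via ((IC ⊗ muB) ∘ (sigma ⊗ IB) ∘ (IC ⊗ psi) ∘ ((w' ∘ (muD ∘ (i ⊗ i))) ⊗ IC)).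
  rewrite (sigma_psi (muD ∘ (i ⊗ i))); symmetry.
  via ((IC ⊗ muB) ∘ (sigma ⊗ IB) ∘ (IC ⊗ (w' ∘ (muD ∘ (i ⊗ i))))).
  rewrite (act_w' i (muD ∘ (i ⊗ i))).
  via (w' ∘ (muD ∘ (ID ⊗ muD)) ∘ (i ⊗ i ⊗ i)).
  rewrite <- muD_assoc; diag.
- rewrite (sigma_psi etaD).
  via (w' ∘ (muD ∘ (etaD ⊗ ID)) ∘ i).
  rewrite muD_unit_l; symmetry.
  via (w' ∘ muD ∘ (i ⊗ (f ∘ etaB))).
  rewrite f_eta.
  via (w' ∘ (muD ∘ (ID ⊗ etaD)) ∘ i).
  rewrite muD_unit_r; diag.
- via ((IC ⊗ muB) ∘ (sigma ⊗ IB) ∘ (IC ⊗ nu)).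
  rewrite (act_w' i etaD); symmetry.
  via (w' ∘ muD ∘ (i ⊗ (f ∘ etaB))).
  rewrite f_eta; diag.
- rewrite (act_w' f etaD).
  via (w' ∘ (muD ∘ (ID ⊗ etaD)) ∘ f).
  rewrite muD_unit_r; diag.
Qed.

(** * The weak crossed coproduct *)

(** Dual to [psi_act]: [chi], [tau] and [ups] arise from [h] equal to [(g ⊗ p) ∘ deltaD],
    [(g ⊗ g) ∘ deltaD] and [epsD]. *)
Lemma coact_w h {X} {H : hom h D X} :
  (IC ⊗ (h ∘ muD ∘ (i ⊗ f))) ∘ (deltaC ⊗ IB) = (p ⊗ h) ∘ deltaD ∘ w.
Proof.
via ((IC ⊗ h) ∘ ((IC ⊗ w) ∘ (deltaC ⊗ IB))).
rewrite w_colinear; diag.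
Qed.

(** Colinearity of [w] and coassociativity bring [w] and [w'] together, and they cancel. *)
Lemma coact_w' h k {X Y} {H : hom h D X} {H' : hom k D Y} :
  ((h ∘ muD ∘ (i ⊗ f)) ⊗ idm Y) ∘ (IC ⊗ ((g ⊗ k) ∘ deltaD ∘ muD ∘ (i ⊗ f))) ∘
  (deltaC ⊗ IB) = (h ⊗ k) ∘ deltaD ∘ w.
Proof.
via (((h ∘ muD ∘ (i ⊗ f)) ⊗ idm Y) ∘
     ((IC ⊗ (((g ⊗ k) ∘ deltaD) ∘ muD ∘ (i ⊗ f))) ∘ (deltaC ⊗ IB))).
rewrite (coact_w ((g ⊗ k) ∘ deltaD)).
via (((h ∘ w) ⊗ k) ∘ (p ⊗ g ⊗ ID) ∘ ((ID ⊗ deltaD) ∘ deltaD) ∘ w).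
rewrite <- deltaD_assoc.
via (((h ∘ (w ∘ w')) ⊗ k) ∘ deltaD ∘ w).
rewrite w_section; diag.
Qed.

Lemma chi_tau h {X} {H : hom h D X} :
  (IB ⊗ (h ∘ muD ∘ (i ⊗ f))) ∘ (chi ⊗ IB) ∘ (IC ⊗ tau) ∘ (deltaC ⊗ IB) =
  (g ⊗ h) ∘ deltaD ∘ w.
Proof.
via ((IB ⊗ (h ∘ muD ∘ (i ⊗ f))) ∘ ((chi ⊗ IB) ∘ (IC ⊗ tau) ∘ (deltaC ⊗ IB))).
rewrite (coact_w' ((g ⊗ p) ∘ deltaD) g).
via ((g ⊗ (h ∘ w)) ∘ (ID ⊗ p ⊗ g) ∘ ((deltaD ⊗ ID) ∘ deltaD) ∘ w).
rewrite deltaD_assoc.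
via ((g ⊗ (h ∘ (w ∘ w'))) ∘ deltaD ∘ w).
rewrite w_section; diag.
Qed.

Lemma GammaC_eq : GammaC C B deltaC epsC chi = w' ∘ w.
Proof.
unfold GammaC.
via ((IC ⊗ IB ⊗ epsC) ∘ ((IC ⊗ chi) ∘ (deltaC ⊗ IB))).
rewrite (coact_w ((g ⊗ p) ∘ deltaD)).
via ((p ⊗ g ⊗ (epsD ∘ i ∘ p)) ∘ (ID ⊗ deltaD) ∘ deltaD ∘ w).
rewrite eps_ip.
via ((p ⊗ (g ∘ ((ID ⊗ epsD) ∘ deltaD))) ∘ deltaD ∘ w).
rewrite deltaD_unit_r; diag.
Qed.

Lemma eps_nabla h {X} {H : hom h B X} :
  (epsC ⊗ h) ∘ (w' ∘ w) = h ∘ g ∘ w.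
Proof.
via (((epsD ∘ i ∘ p) ⊗ (h ∘ g)) ∘ deltaD ∘ w).
rewrite eps_ip.
via (h ∘ g ∘ ((epsD ⊗ ID) ∘ deltaD) ∘ w).
rewrite deltaD_unit_l; diag.
Qed.

Lemma deltaP_eq : deltaP C B deltaC chi tau = (w' ⊗ w') ∘ deltaD ∘ w.
Proof.
unfold deltaP.
via ((((IC ⊗ chi) ∘ (deltaC ⊗ IB)) ⊗ IB) ∘ ((IC ⊗ tau) ∘ (deltaC ⊗ IB))).
rewrite (coact_w ((g ⊗ p) ∘ deltaD)), (coact_w ((g ⊗ g) ∘ deltaD)).
via (((p ⊗ g ⊗ p) ⊗ g) ∘ (((ID ⊗ deltaD) ∘ deltaD ∘ w) ⊗ ID) ∘ (p ⊗ g ⊗ ID) ∘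
     ((ID ⊗ deltaD) ∘ deltaD) ∘ w).
rewrite <- deltaD_assoc.
via (((p ⊗ g ⊗ p) ⊗ g) ∘ (((deltaD ⊗ ID) ∘ deltaD ∘ (w ∘ w')) ⊗ ID) ∘ deltaD ∘ w).
rewrite w_section.
via ((p ⊗ g ⊗ p ⊗ g) ∘ (deltaD ⊗ ID ⊗ ID) ∘ ((deltaD ⊗ ID) ∘ deltaD) ∘ w).
rewrite deltaD_assoc; diag.
Qed.

Lemma crossed_coproduct :
  is_weak_crossed_coproduct_precounit C B deltaC epsC chi tau ups.
Proof.
unfold is_weak_crossed_coproduct_precounit; rewrite GammaC_eq, (eps_nabla IB).
split; [diag_hom | split; [diag_hom | split; [diag_hom |]]].
split; [| split; [| split; [| split; [| split; [| split; [| split]]]]]].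
- rewrite (coact_w' ((g ⊗ p) ∘ deltaD) p); symmetry.
  via ((g ⊗ (deltaC ∘ p)) ∘ deltaD ∘ w).
  rewrite p_comul.
  via ((g ⊗ p ⊗ p) ∘ ((ID ⊗ deltaD) ∘ deltaD) ∘ w).
  rewrite <- deltaD_assoc; diag.
- via (w' ∘ (w ∘ w') ∘ w).
  rewrite w_section; diag.
- via ((g ⊗ g) ∘ deltaD ∘ (w ∘ w') ∘ w).
  rewrite w_section; diag.
- rewrite (coact_w' ((g ⊗ g) ∘ deltaD) p), (chi_tau ((g ⊗ p) ∘ deltaD)).
  via ((g ⊗ g ⊗ p) ∘ ((deltaD ⊗ ID) ∘ deltaD) ∘ w).
  rewrite deltaD_assoc; diag.
- rewrite (coact_w' ((g ⊗ g) ∘ deltaD) g), (chi_tau ((g ⊗ g) ∘ deltaD)).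
  via ((g ⊗ g ⊗ g) ∘ ((deltaD ⊗ ID) ∘ deltaD) ∘ w).
  rewrite deltaD_assoc; diag.
- rewrite (chi_tau epsD).
  via (g ∘ ((ID ⊗ epsD) ∘ deltaD) ∘ w).
  rewrite deltaD_unit_r; diag.
- rewrite (coact_w' epsD g).
  via (g ∘ ((epsD ⊗ ID) ∘ deltaD) ∘ w).
  rewrite deltaD_unit_l; diag.
- rewrite (coact_w' epsD p); unfold gammaC; rewrite (coact_w epsD).
  via (p ∘ ((epsD ⊗ ID) ∘ deltaD) ∘ w).
  rewrite deltaD_unit_l; symmetry.
  via (p ∘ ((ID ⊗ epsD) ∘ deltaD) ∘ w).
  rewrite deltaD_unit_r; diag.
Qed.

(** * The weak crossed biproduct and its identities *)

Lemma image_iso X j q :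
  hom j X (ten C B) -> hom q (ten C B) X -> j ∘ q = w' ∘ w -> q ∘ j = idm X ->
  exists alpha alpha' : Mor S,
    hom alpha X D /\ hom alpha' D X /\
    alpha' ∘ alpha = idm X /\ alpha ∘ alpha' = idm D /\
    is_algebra_morphism X (q ∘ nu) (q ∘ muP C B muB psi sigma ∘ (j ⊗ j))
                        D etaD muD alpha /\
    is_coalgebra_morphism X ((q ⊗ q) ∘ deltaP C B deltaC chi tau ∘ j) (ups ∘ j)
                          D deltaD epsD alpha.
Proof.
intros Hj Hq jq qj.
assert (E : w ∘ j ∘ (q ∘ w') = ID).
{ via (w ∘ (j ∘ q) ∘ w').
  rewrite jq.
  via ((w ∘ w') ∘ (w ∘ w')).
  rewrite w_section; diag. }
(* Both [(j, q)] and [(w', w)] split the same idempotent, which gives the comparison isomorphism. *)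
exists (w ∘ j), (q ∘ w'); rewrite muP_eq, deltaP_eq.
split; [diag_hom | split; [diag_hom | split; [| split; [exact E | split]]]].
- via (q ∘ (w' ∘ w) ∘ j).
  rewrite <- jq.
  via ((q ∘ j) ∘ (q ∘ j)).
  rewrite qj; diag.
- split; [diag_hom | split].
  + via ((w ∘ j ∘ (q ∘ w')) ∘ etaD).
    rewrite E; diag.
  + via ((w ∘ j ∘ (q ∘ w')) ∘ muD ∘ ((w ∘ j) ⊗ (w ∘ j))).
    rewrite E; diag.
- split; [diag_hom | split; [symmetry | diag]].
  via (((w ∘ j ∘ (q ∘ w')) ⊗ (w ∘ j ∘ (q ∘ w'))) ∘ deltaD ∘ w ∘ j).
  rewrite E; diag.
Qed.

Lemma crossed_biproduct :
  is_weak_crossed_biproduct D etaD muD epsD deltaD C deltaC epsC B etaB muB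
    psi sigma chi tau nu ups.
Proof.
split; [exact crossed_product | split; [exact crossed_coproduct |]].
rewrite nablaP_eq, GammaC_eq.
split; [reflexivity | split; [exact image_iso | split]].
- via (((epsD ∘ i ∘ p) ⊗ g) ∘ deltaD ∘ etaD).
  rewrite eps_ip.
  via (g ∘ ((epsD ⊗ ID) ∘ deltaD) ∘ etaD).
  rewrite deltaD_unit_l, <- f_eta.
  via ((g ∘ f) ∘ etaB).
  rewrite gf; diag.
- via (epsD ∘ muD ∘ (i ⊗ (f ∘ etaB))).
  rewrite f_eta.
  via (epsD ∘ (muD ∘ (ID ⊗ etaD)) ∘ i).
  rewrite muD_unit_r; diag.
Qed.

Lemma deltaP_betaP :
  deltaP C B deltaC chi tau ∘ betaP C B muB nu =
  (betaP C B muB nu ⊗ betaP C B muB nu) ∘ deltaB.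
Proof.
rewrite deltaP_eq, betaP_eq.
via ((w' ⊗ w') ∘ deltaD ∘ (w ∘ w') ∘ f).
rewrite w_section.
via ((w' ⊗ w') ∘ (deltaD ∘ f)).
rewrite f_delta; diag.
Qed.

Lemma tau_nabla : tau = (epsC ⊗ deltaB) ∘ nablaP C B etaB muB psi.
Proof. rewrite nablaP_eq, (eps_nabla deltaB), g_delta; diag. Qed.

Lemma ups_nabla : ups = (epsC ⊗ epsB) ∘ nablaP C B etaB muB psi.
Proof. rewrite nablaP_eq, (eps_nabla epsB), g_eps; diag. Qed.

Lemma ip_idempotent : i ∘ p ∘ (i ∘ p) = i ∘ p.
Proof. via (i ∘ (p ∘ i) ∘ p); rewrite pi; diag. Qed.
End WeakProjection.

Theorem theorem3p9 (S : sbmcat) (D B DB : Ob S)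
  (etaD muD epsD deltaD etaB muB epsB deltaB lamB f g iD pD : Mor S) :
  is_weak_projection D etaD muD epsD deltaD B etaB muB epsB deltaB lamB f g ->
  (* t_B^D = i_B^D o p_B^D,  p_B^D o i_B^D = id *)
  hom iD DB D -> hom pD D DB ->
  iD ∘ pD = muD ∘ (idm D ⊗ (f ∘ lamB ∘ g)) ∘ deltaD ->
  pD ∘ iD = idm DB ->
  let t := muD ∘ (idm D ⊗ (f ∘ lamB ∘ g)) ∘ deltaD in
  let deltaDB := (pD ⊗ pD) ∘ deltaD ∘ iD in
  let epsDB := epsD ∘ iD in
  let psi := (pD ⊗ g) ∘ deltaD ∘ muD ∘ (f ⊗ iD) in
  let sigma := (pD ⊗ g) ∘ deltaD ∘ muD ∘ (iD ⊗ iD) in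
  let chi := (g ⊗ pD) ∘ deltaD ∘ muD ∘ (iD ⊗ f) in
  let tau := (g ⊗ g) ∘ deltaD ∘ muD ∘ (iD ⊗ f) in
  let nu := (pD ⊗ g) ∘ deltaD ∘ etaD in
  let ups := epsD ∘ muD ∘ (iD ⊗ f) in
  let nabla := nablaP DB B etaB muB psi in
  let beta := betaP DB B muB nu in
  t ∘ t = t /\
  is_coalgebra DB deltaDB epsDB /\
  is_weak_crossed_biproduct D etaD muD epsD deltaD DB deltaDB epsDB B etaB muB
    psi sigma chi tau nu ups /\
  deltaP DB B deltaDB chi tau ∘ beta = (beta ⊗ beta) ∘ deltaB /\
  tau = (epsDB ⊗ deltaB) ∘ nabla /\
  ups = (epsDB ⊗ epsB) ∘ nabla.
Proof.
intros HP Hi Hp ip pi; cbv zeta; rewrite <- ip.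
split; [exact (ip_idempotent Hi Hp pi) |].
split; [exact (C_coalgebra HP Hi Hp ip pi) |].
split; [exact (crossed_biproduct HP Hi Hp ip pi) |].
split; [exact (deltaP_betaP HP Hi Hp ip pi) |].
split; [exact (tau_nabla HP Hi Hp ip pi) | exact (ups_nabla HP Hi Hp ip pi)].
Qed.
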